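(* Let $F$ be a field of characteristic $2$ and let $K$ be a purely inseparable extension of $F$ of exponent $1$ (i.e. $K^2\subseteq F$). Let $n\ge 1$ and let $B=\langle\!\langle a_1,\dots,a_n\rangle\!\rangle_b$, $a_i\in F^*$, be an $n$-fold bilinear Pfister form over $F$ with associated totally singular quadratic form $q=\langle\!\langle a_1,\dots,a_n\rangle\!\rangle$, $q(x)=B(x,x)$. Let $k\le n$ and $1\le i_1<\dots<i_k\le n$ be such that $(q_K)_{\mathrm{an}}\cong\langle\!\langle a_{i_1},\dots,a_{i_k}\rangle\!\rangle_K$, and put $B_0=\langle\!\langle a_{i_1},\dots,a_{i_k}\rangle\!\rangle_b$. Let $L=K(B)$. If $\dim B_0=1$, then $W_q(L/F)=W_q(K/F)$. If $\dim B_0>1$, then $$W_q(L/F)=W_q(K/F)+B_0\otimes W_q(F).$$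
   Context: All fields have characteristic $2$; all forms are on finite-dimensional vector spaces; bilinear forms are symmetric and nonsingular. $\langle a_1,\dots,a_n\rangle_b$ denotes the diagonal bilinear form with entries $a_i\in F^*$. The $n$-fold bilinear Pfister form is $\langle\!\langle a_1,\dots,a_n\rangle\!\rangle_b=\langle 1,a_1\rangle_b\otimes\dots\otimes\langle 1,a_n\rangle_b$ (for $n=0$ it is $\langle 1\rangle_b$), and $\langle\!\langle a_1,\dots,a_n\rangle\!\rangle$ is the associated totally singular quadratic form $q(x)=B(x,x)$, i.e. the diagonal quadratic form $\sum_{I\subseteq\{1,\dots,n\}}\bigl(\prod_{i\in I}a_i\bigr)x_I^2$. For a totally singular (diagonal) quadratic form $q$ over a field, $q\cong q_{\mathrm{an}}\perp\langle 0,\dots,0\rangle$ with $q_{\mathrm{an}}$ anisotropic, unique up to isometry; $q_{\mathrm{an}}$ is the anisotropic part. A subscript $K$ denotes scalar extension to $K$. Indices $k,i_1,\dots,i_k$ as in the claim always exist. The function field $K(B)$ is defined as $K(q)$, the function field of the (reduced) projective quadric over $K$ given by $q_K=0$; it is a purely transcendental extension of $K((q_K)_{\mathrm{an}})=K(B_0)$, where $K(B_0)=K$ if $\dim B_0=1$. A quadratic form $q$ is nonsingular if its polar form $B_q(x,y)=q(x+y)+q(x)+q(y)$ has zero radical. $W_q(F)$ is the Witt group of nonsingular quadratic forms over $F$ (classes up to isometry and hyperbolic planes $xy$, addition induced by $\perp$). It is a module over the Witt ring $W(F)$ of nonsingular symmetric bilinear forms via $\langle a_1,\dots,a_n\rangle_b\otimes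 q=a_1q\perp\dots\perp a_nq$. For a field extension $L/F$, $W_q(L/F)$ is the kernel of the scalar extension map $W_q(F)\to W_q(L)$. *)

(* Defs.v *)
From HB Require Import structures.
From mathcomp Require Import all_boot all_order all_algebra.
From mathcomp Require Import generic_quotient.
From mathcomp Require Import boolp classical_sets.
From mathcomp Require Import ring mpoly.

Set Implicit Arguments.
Unset Strict Implicit.
Unset Printing Implicit Defensive.

Import GRing.Theory.
Local Open Scope ring_scope.
Local Open Scope quotient_scope.

(* A quadratic form on F^n is given by any matrix A such that its value at the
   row vector x is x A x^T; different matrices may define the same form, and
   they are then isometric in the sense of [isometric]. *)
Definition qform (F : fieldType) : Type := {n : nat & 'M[F]_n}.
HB.instance Definition _ (F : fieldType) := Choice.on (qform F).

Section QuadraticForms.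
Variable F : fieldType.
Implicit Types (phi psi chi : qform F).

Definition qdim phi : nat := tag phi.

Definition qval phi (x : 'rV[F]_(qdim phi)) : F :=
  (x *m tagged phi *m x^T) 0 0.

Definition polar phi (x y : 'rV[F]_(qdim phi)) : F :=
  qval (x + y) - qval x - qval y.

Definition nonsingular phi : Prop :=
  forall x, (forall y, @polar phi x y = 0) -> x = 0.

Definition anisotropic phi : Prop :=
  forall x, @qval phi x = 0 -> x = 0.

Definition isometric phi psi : Prop :=
  exists f : 'rV[F]_(qdim phi) -> 'rV[F]_(qdim psi),
    [/\ linear f, bijective f & forall x, qval (f x) = qval x].

Definition orth phi psi : qform F :=
  existT _ (qdim phi + qdim psi)%N
    (block_mx (tagged phi) 0 0 (tagged psi)).

Definition scaleq (a : F) phi : qform F :=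
  existT _ (qdim phi) (a *: tagged phi).

Definition zeroq (m : nat) : qform F := existT _ m (0 : 'M[F]_m).

(* u_1 y_1 + ... + u_r y_r: the orthogonal sum of r hyperbolic planes. *)
Definition hyp (r : nat) : qform F :=
  existT _ (r + r)%N (block_mx 0 1%:M 0 0).

Definition witt_equiv phi psi : Prop :=
  exists r s, isometric (orth phi (hyp r)) (orth psi (hyp s)).

(* phi0 is (isometric to) the anisotropic part of the totally singular
   form phi. *)
Definition anisotropic_part phi phi0 : Prop :=
  anisotropic phi0 /\ exists m, isometric phi (orth phi0 (zeroq m)).

End QuadraticForms.

Definition map_qform (F K : fieldType) (f : {rmorphism F -> K})
    (phi : qform F) : qform K :=
  existT _ (qdim phi) (map_mx f (tagged phi)).

Section IsometryTheory.
Variable F : fieldType.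
Implicit Types (phi psi chi : qform F).

Lemma isom_refl phi : isometric phi phi.
Proof. by exists id; split => //; exists id. Qed.

Lemma isom_trans psi phi chi :
  isometric phi psi -> isometric psi chi -> isometric phi chi.
Proof.
move=> [f [lf bf qf]] [g [lg bg qg]]; exists (g \o f); split.
- by move=> a x y /=; rewrite lf lg.
- exact: bij_comp.
- by move=> x /=; rewrite qg qf.
Qed.

Lemma isom_sym phi psi : isometric phi psi -> isometric psi phi.
Proof.
move=> [f [lf [g fK gK] qf]]; exists g; split.
- by move=> a x y; apply: (can_inj fK); rewrite lf !gK.
- by exists f.
- by move=> x; rewrite -qf gK.
Qed.

Lemma qval_orth phi psi (x : 'rV[F]_(qdim phi)) (y : 'rV[F]_(qdim psi)) :
  @qval F (orth phi psi) (row_mx x y) = qval x + qval y.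
Proof.
rewrite /qval /= mul_row_block !mulmx0 addr0 add0r tr_row_mx mul_row_col.
by rewrite mxE.
Qed.

Lemma qval_orthE phi psi (v : 'rV[F]_(qdim phi + qdim psi)) :
  @qval F (orth phi psi) v = qval (lsubmx v) + qval (rsubmx v).
Proof. by rewrite -qval_orth hsubmxK. Qed.

Lemma qval_hyp r (x y : 'rV[F]_r) :
  @qval F (hyp F r) (row_mx x y) = (x *m y^T) 0 0.
Proof.
rewrite /qval /= mul_row_block !mulmx0 !mulmx1 !addr0 tr_row_mx mul_row_col.
by rewrite mul0mx add0r.
Qed.

Lemma qval_hypE r (v : 'rV[F]_(r + r)) :
  @qval F (hyp F r) v = (lsubmx v *m (rsubmx v)^T) 0 0.
Proof. by rewrite -qval_hyp hsubmxK. Qed.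

Lemma isom_orth phi phi' psi psi' : isometric phi phi' ->
  isometric psi psi' -> isometric (orth phi psi) (orth phi' psi').
Proof.
move=> [f [lf [f' fK f'K] qf]] [g [lg [g' gK g'K] qg]].
exists (fun v : 'rV[F]_(qdim phi + qdim psi) =>
          row_mx (f (lsubmx v)) (g (rsubmx v))); split.
- by move=> a x y; rewrite !linearP lf lg scale_row_mx add_row_mx.
- exists (fun v : 'rV[F]_(qdim phi' + qdim psi') =>
            row_mx (f' (lsubmx v)) (g' (rsubmx v))) => v.
  + by rewrite row_mxKl row_mxKr fK gK hsubmxK.
  + by rewrite row_mxKl row_mxKr f'K g'K hsubmxK.
- by move=> v; rewrite qval_orth qf qg -qval_orthE.
Qed.

Lemma isom_orthC phi psi : isometric (orth phi psi) (orth psi phi).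
Proof.
exists (fun v : 'rV[F]_(qdim phi + qdim psi) =>
          row_mx (rsubmx v) (lsubmx v)); split.
- by move=> a x y; rewrite !linearP scale_row_mx add_row_mx.
- exists (fun v : 'rV[F]_(qdim psi + qdim phi) =>
            row_mx (rsubmx v) (lsubmx v)) => v /=;
  by rewrite row_mxKl row_mxKr hsubmxK.
- by move=> v; rewrite qval_orth addrC -qval_orthE.
Qed.

Lemma isom_orthA phi psi chi :
  isometric (orth phi (orth psi chi)) (orth (orth phi psi) chi).
Proof.
exists (fun v : 'rV[F]_(qdim phi + (qdim psi + qdim chi)) =>
  row_mx (row_mx (lsubmx v) (lsubmx (rsubmx v))) (rsubmx (rsubmx v))); split.
- by move=> a x y; rewrite !linearP !scale_row_mx !add_row_mx.
- exists (fun v : 'rV[F]_(qdim phi + qdim psi + qdim chi) =>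
    row_mx (lsubmx (lsubmx v)) (row_mx (rsubmx (lsubmx v)) (rsubmx v))) => v /=;
  by rewrite !(row_mxKl, row_mxKr) !hsubmxK.
- move=> v; rewrite (@qval_orth (orth phi psi) chi) qval_orth -addrA.
  by rewrite -(@qval_orthE psi chi) -(@qval_orthE phi (orth psi chi)).
Qed.

Lemma isom_orthAC phi psi chi :
  isometric (orth (orth phi psi) chi) (orth (orth phi chi) psi).
Proof.
apply: isom_trans (isom_sym (isom_orthA _ _ _)) _.
apply: isom_trans (isom_orthA _ _ _).
exact: isom_orth (isom_refl _) (isom_orthC _ _).
Qed.

Lemma isom_orth0 phi : isometric (orth phi (zeroq F 0)) phi.
Proof.
exists (fun v : 'rV[F]_(qdim phi + 0) => lsubmx v); split.
- exact: linearP.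
- exists (fun x : 'rV[F]_(qdim phi) => row_mx x (0 : 'rV[F]_0)) => v.
  + by rewrite -[RHS]hsubmxK [rsubmx v]thinmx0.
  + exact: row_mxKl.
- by move=> v; rewrite qval_orthE [X in _ + X]mxE big_ord0 addr0.
Qed.

Lemma isom_hyp0 : isometric (hyp F 0) (zeroq F 0).
Proof.
exists id; split => //; first by exists id.
by move=> x; rewrite /qval !mxE !big_ord0.
Qed.

Lemma isom_hypD r s : isometric (orth (hyp F r) (hyp F s)) (hyp F (r + s)).
Proof.
exists (fun v : 'rV[F]_((r + r) + (s + s)) =>
  row_mx (row_mx (lsubmx (lsubmx v)) (lsubmx (rsubmx v)))
         (row_mx (rsubmx (lsubmx v)) (rsubmx (rsubmx v)))); split.
- by move=> a x y; rewrite !linearP !scale_row_mx !add_row_mx.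
- exists (fun v : 'rV[F]_((r + s) + (r + s)) =>
  row_mx (row_mx (lsubmx (lsubmx v)) (lsubmx (rsubmx v)))
         (row_mx (rsubmx (lsubmx v)) (rsubmx (rsubmx v)))) => v /=;
  by rewrite !(row_mxKl, row_mxKr) !hsubmxK.
- move=> v; rewrite qval_orthE !qval_hypE row_mxKl row_mxKr.
  by rewrite tr_row_mx mul_row_col mxE.
Qed.

Lemma qval_scale a phi (x : 'rV[F]_(qdim phi)) :
  @qval F (scaleq a phi) x = a * qval x.
Proof. by rewrite /qval /= -scalemxAr -scalemxAl mxE. Qed.

Lemma isom_scale a phi psi :
  isometric phi psi -> isometric (scaleq a phi) (scaleq a psi).
Proof.
move=> [f [lf bf qf]]; exists f; split => // x.
by rewrite !qval_scale qf.
Qed.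

Lemma scaleq_orth a phi psi :
  scaleq a (orth phi psi) = orth (scaleq a phi) (scaleq a psi).
Proof. by rewrite /scaleq /orth /= scale_block_mx !scaler0. Qed.

Lemma isom_scale_hyp a r : a != 0 -> isometric (scaleq a (hyp F r)) (hyp F r).
Proof.
move=> a0; exists (fun v : 'rV[F]_(r + r) =>
  row_mx (a *: lsubmx v) (rsubmx v)); split.
- by move=> b x y; rewrite !linearP scale_row_mx add_row_mx.
- exists (fun v : 'rV[F]_(r + r) => row_mx (a^-1 *: lsubmx v) (rsubmx v)) => v /=;
  by rewrite row_mxKl row_mxKr scalerA ?mulVf ?mulfV // scale1r hsubmxK.
- by move=> v; rewrite qval_hyp -scalemxAl mxE -qval_hypE qval_scale.
Qed.

Lemma polarE phi (x y : 'rV[F]_(qdim phi)) :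
  polar x y = (x *m (tagged phi + (tagged phi)^T) *m y^T) 0 0.
Proof.
have addE (A B : 'M[F]_1) : (A + B) 0 0 = A 0 0 + B 0 0 by rewrite mxE.
rewrite /polar /qval linearD /= !mulmxDr !mulmxDl !addE.
have -> : (x *m (tagged phi)^T *m y^T) 0 0 = (y *m tagged phi *m x^T) 0 0.
  by rewrite -[in LHS]mulmxA -trmx_mul -{1}[x]trmxK -trmx_mul mxE.
by ring.
Qed.

Lemma nonsingularP phi :
  nonsingular phi <-> tagged phi + (tagged phi)^T \in unitmx.
Proof.
split=> [ns | u x x0].
- rewrite -row_free_unit -kermx_eq0; apply/eqP/row_matrixP => i.
  rewrite row0; apply: ns => y; rewrite polarE.
  suff -> : row i (kermx (tagged phi + (tagged phi)^T))
              *m (tagged phi + (tagged phi)^T) = 0 by rewrite mul0mx mxE.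
  by rewrite -row_mul mulmx_ker row0.
- suff x1 : x *m (tagged phi + (tagged phi)^T) = 0.
    by rewrite -(mulmxK u x) x1 mul0mx.
  apply/rowP => i; have := x0 (delta_mx 0 i).
  by rewrite polarE trmx_delta -colE !mxE.
Qed.

Lemma nonsingular_orth phi psi :
  nonsingular phi -> nonsingular psi -> nonsingular (orth phi psi).
Proof.
move=> /nonsingularP u /nonsingularP v; apply/nonsingularP => /=.
rewrite tr_block_mx !trmx0 add_block_mx !addr0 unitmxE det_ublock unitrM.
by rewrite -!unitmxE u.
Qed.

Lemma nonsingular_scale a phi :
  a != 0 -> nonsingular phi -> nonsingular (scaleq a phi).
Proof.
move=> a0 /nonsingularP u; apply/nonsingularP => /=.
by rewrite linearZ /= -scalerDr unitmxZ // unitfE.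
Qed.

Lemma nonsingular_zeroq0 : nonsingular (zeroq F 0).
Proof. by move=> x _; exact: thinmx0. Qed.

Lemma linear_mx m n (f : 'rV[F]_m -> 'rV[F]_n) :
  linear f -> exists P, forall x, f x = x *m P.
Proof.
move=> lf.
pose lfM := GRing.isLinear.Build F 'rV[F]_m 'rV[F]_n *:%R f lf.
pose g : {linear 'rV[F]_m -> 'rV[F]_n} := HB.pack f lfM.
by exists (lin1_mx g) => x; rewrite mul_rV_lin1.
Qed.

Lemma isom_orthN phi : nonsingular phi ->
  isometric (orth phi (scaleq (-1) phi)) (hyp F (qdim phi)).
Proof.
move=> /nonsingularP u.
set A := tagged phi in u; set M := A + A^T in u.
exists (fun v : 'rV[F]_(qdim phi + qdim phi) =>
  row_mx (lsubmx v - rsubmx v)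
         ((lsubmx v - rsubmx v) *m A^T + rsubmx v *m M)); split.
- move=> a x y; rewrite !linearP scale_row_mx add_row_mx /=.
  rewrite addrACA -scalerDr !mulmxDl -!scalemxAl addrACA.
  by rewrite -mulmxDl -scalerDr -!mulmxDl.
- exists (fun v : 'rV[F]_(qdim phi + qdim phi) =>
    let y := (rsubmx v - lsubmx v *m A^T) *m invmx M in
    row_mx (lsubmx v + y) y) => v /=.
  + rewrite row_mxKl row_mxKr [_ *m A^T + _]addrC addrK mulmxK // subrK.
    exact: hsubmxK.
  + by rewrite row_mxKl row_mxKr addrK mulmxKV // [_ *m A^T + _]addrC subrK hsubmxK.
- move=> v; rewrite qval_hyp qval_orthE.
  set x := lsubmx v; set y := rsubmx v.
  rewrite qval_scale mulN1r.
  rewrite linearD /= !trmx_mul trmxK mulmxDr [in LHS]mxE.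
  have -> : (x - y) *m (M^T *m y^T) = (x - y) *m M *m y^T.
    by rewrite mulmxA /M linearD /= trmxK [A^T + _]addrC.
  rewrite -(polarE (x - y) y) mulmxA -/(qval (x - y)) /polar subrK.
  by rewrite -addrA addrC -addrA; ring.
Qed.

Lemma witt_equiv_refl phi : witt_equiv phi phi.
Proof. by exists 0, 0; exact: isom_refl. Qed.

Lemma witt_equiv_sym phi psi : witt_equiv phi psi -> witt_equiv psi phi.
Proof. by move=> [r [s h]]; exists s, r; exact: isom_sym. Qed.

Lemma orth_hypD phi r s :
  isometric (orth phi (hyp F (r + s))) (orth (orth phi (hyp F r)) (hyp F s)).
Proof.
apply: isom_trans (isom_orthA _ _ _).
exact: isom_orth (isom_refl _) (isom_sym (isom_hypD _ _)).
Qed.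

Lemma witt_equiv_trans psi phi chi :
  witt_equiv phi psi -> witt_equiv psi chi -> witt_equiv phi chi.
Proof.
move=> [r [s h]] [t [u k]]; exists (r + t)%N, (u + s)%N.
apply: isom_trans (orth_hypD _ _ _) _.
apply: isom_trans (isom_orth h (isom_refl _)) _.
apply: isom_trans (isom_orthAC _ _ _) _.
apply: isom_trans (isom_orth k (isom_refl _)) _.
exact: isom_sym (orth_hypD _ _ _).
Qed.

Lemma witt_equiv_isom phi psi : isometric phi psi -> witt_equiv phi psi.
Proof. by move=> h; exists 0, 0; exact: isom_orth h (isom_refl _). Qed.

Lemma witt_equiv_orthr phi psi chi :
  witt_equiv phi psi -> witt_equiv (orth phi chi) (orth psi chi).
Proof.
move=> [r [s h]]; exists r, s.
apply: isom_trans (isom_orthAC _ _ _) _.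
apply: isom_trans (isom_orth h (isom_refl _)) _.
exact: isom_orthAC.
Qed.

Lemma witt_equiv_orth phi phi' psi psi' : witt_equiv phi phi' ->
  witt_equiv psi psi' -> witt_equiv (orth phi psi) (orth phi' psi').
Proof.
move=> h k; apply: witt_equiv_trans (witt_equiv_orthr _ h) _.
apply: witt_equiv_trans (witt_equiv_isom (isom_orthC _ _)) _.
apply: witt_equiv_trans (witt_equiv_orthr _ k) _.
exact: witt_equiv_isom (isom_orthC _ _).
Qed.

Lemma witt_equiv_scale a phi psi : a != 0 ->
  witt_equiv phi psi -> witt_equiv (scaleq a phi) (scaleq a psi).
Proof.
move=> a0 [r [s h]]; exists r, s.
apply: isom_trans (isom_orth (isom_refl _) (isom_sym (isom_scale_hyp r a0))) _.
apply: isom_trans _ (isom_orth (isom_refl _) (isom_scale_hyp s a0)).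
by rewrite -!scaleq_orth; exact: isom_scale.
Qed.

Lemma witt_equiv_hyp r : witt_equiv (hyp F r) (zeroq F 0).
Proof.
exists 0, r; apply: isom_trans (isom_orthC _ _).
exact: isom_orth (isom_refl _) isom_hyp0.
Qed.

End IsometryTheory.

Section ScalarExtension.
Variables (F K : fieldType) (f : {rmorphism F -> K}).

Lemma map_orth phi psi :
  map_qform f (orth phi psi) = orth (map_qform f phi) (map_qform f psi).
Proof. by rewrite /map_qform /orth /= map_block_mx !map_mx0. Qed.

Lemma map_hyp r : map_qform f (hyp F r) = hyp K r.
Proof. by rewrite /map_qform /hyp /= map_block_mx !map_mx0 map_mx1. Qed.

Lemma nonsingular_map phi : nonsingular phi -> nonsingular (map_qform f phi).
Proof.
move=> /nonsingularP u; apply/nonsingularP => /=.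
by rewrite map_trmx -map_mxD map_unitmx.
Qed.

(* A matrix whose quadratic form vanishes is alternating, hence its form also
   vanishes after scalar extension. *)
Lemma map_qval0 n (D : 'M[F]_n) :
  (forall x : 'rV[F]_n, (x *m D *m x^T) 0 0 = 0) ->
  forall x : 'rV[K]_n, (x *m map_mx f D *m x^T) 0 0 = 0.
Proof.
move=> D0.
have addE (A B : 'M[F]_1) : (A + B) 0 0 = A 0 0 + B 0 0 by rewrite mxE.
have Dij i j : ((delta_mx 0 i : 'rV[F]_n) *m D
                  *m (delta_mx 0 j : 'rV[F]_n)^T) 0 0 = D i j.
  by rewrite trmx_delta -colE -rowE !mxE.
have Dii i : D i i = 0 by rewrite -Dij D0.
have DN i j : D i j = - D j i.
  apply/eqP; rewrite -addr_eq0; apply/eqP.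
  have := D0 (delta_mx 0 i + delta_mx 0 j).
  rewrite linearD /= !mulmxDr !mulmxDl !addE !Dij !Dii.
  by rewrite add0r addr0 addrC.
pose U := \matrix_(i, j) if (i < j)%N then D i j else 0.
have -> : D = U - U^T.
  apply/matrixP => i j; rewrite !mxE.
  have [ij|ji|/val_inj ->] := ltngtP i j; rewrite ?subr0 ?sub0r ?Dii //.
move=> x; rewrite map_mxB mulmxBr mulmxBl -map_trmx mxE [X in _ + X]mxE.
apply/eqP; rewrite subr_eq0; apply/eqP.
have -> : x *m (map_mx f U)^T *m x^T = (x *m map_mx f U *m x^T)^T.
  by rewrite !trmx_mul trmxK mulmxA.
by rewrite [RHS]mxE.
Qed.

Lemma isom_map phi psi : isometric phi psi ->
  isometric (map_qform f phi) (map_qform f psi).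
Proof.
move=> [g [lg [h gK hK] qg]].
have [P gP] := linear_mx lg.
have lh : linear h by move=> a x y; apply: (can_inj gK); rewrite lg !hK.
have [Q hQ] := linear_mx lh.
have PQ : P *m Q = 1%:M.
  by apply/row_matrixP => i; rewrite rowE mulmxA -gP -hQ gK rowE mulmx1.
have QP : Q *m P = 1%:M.
  by apply/row_matrixP => i; rewrite rowE mulmxA -hQ -gP hK rowE mulmx1.
exists (fun x : 'rV[K]_(qdim phi) => x *m map_mx f P); split.
- by move=> a x y; rewrite mulmxDl scalemxAl.
- exists (fun x : 'rV[K]_(qdim psi) => x *m map_mx f Q) => x;
  by rewrite -mulmxA -map_mxM ?PQ ?QP map_mx1 mulmx1.
- move=> x; rewrite /qval /=.
  have subE (R : fieldType) (A B : 'M[R]_1) : (A - B) 0 0 = A 0 0 - B 0 0.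
    by rewrite !mxE.
  have := @map_qval0 _ (P *m tagged psi *m P^T - tagged phi) _ x.
  rewrite map_mxB !map_mxM -map_trmx mulmxBr mulmxBl subE.
  rewrite trmx_mul !mulmxA => e; apply/eqP; rewrite -subr_eq0 e // => y.
  rewrite mulmxBr mulmxBl subE.
  have := qg y; rewrite gP /qval trmx_mul !mulmxA => ->.
  by rewrite subrr.
Qed.

Lemma witt_equiv_map phi psi : witt_equiv phi psi ->
  witt_equiv (map_qform f phi) (map_qform f psi).
Proof.
move=> [r [s h]]; exists r, s.
by rewrite -!map_hyp -!map_orth; exact: isom_map.
Qed.

End ScalarExtension.

Definition nsform (F : fieldType) : Type :=
  {phi : qform F | `[< nonsingular phi >]}.
HB.instance Definition _ (F : fieldType) := Choice.on (nsform F).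

Definition mk_nsform (F : fieldType) (phi : qform F) (h : nonsingular phi) :
  nsform F := exist _ phi (asboolT h).

Lemma nsformP (F : fieldType) (phi : nsform F) : nonsingular (val phi).
Proof. exact: asboolW (valP phi). Qed.
Arguments nsformP {F} phi.

Section WittGroup.
Variable F : fieldType.

Definition witt_rel : rel (nsform F) :=
  fun phi psi => `[< witt_equiv (val phi) (val psi) >].

Lemma witt_rel_refl : reflexive witt_rel.
Proof. by move=> phi; apply/asboolP; exact: witt_equiv_refl. Qed.

Lemma witt_rel_sym : ssrbool.symmetric witt_rel.
Proof. by move=> phi psi; apply/asboolP/asboolP; exact: witt_equiv_sym. Qed.

Lemma witt_rel_trans : transitive witt_rel.
Proof.
move=> psi phi chi /asboolP h /asboolP k; apply/asboolP.
exact: witt_equiv_trans h k.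
Qed.

Canonical witt_equivRel :=
  EquivRel witt_rel witt_rel_refl witt_rel_sym witt_rel_trans.

Definition Wq : Type := {eq_quot witt_equivRel}.
HB.instance Definition _ := Choice.on Wq.

Definition wclass (phi : nsform F) : Wq := \pi_({eq_quot witt_equivRel}) phi.
Definition wrepr (w : Wq) : nsform F := repr (w : {eq_quot witt_equivRel}).

Lemma wreprK w : wclass (wrepr w) = w.
Proof. exact: reprK. Qed.

Lemma wclassP phi psi :
  wclass phi = wclass psi <-> witt_equiv (val phi) (val psi).
Proof. by split=> [/eqmodP/asboolP | h]; last exact/eqmodP/asboolP. Qed.

Lemma wreprP phi : witt_equiv (val (wrepr (wclass phi))) (val phi).
Proof. by apply/wclassP; exact: wreprK. Qed.

Definition nsorth (phi psi : nsform F) : nsform F :=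
  mk_nsform (nonsingular_orth (nsformP phi) (nsformP psi)).

Definition nsscale (a : F) (a0 : a != 0) (phi : nsform F) : nsform F :=
  mk_nsform (nonsingular_scale a0 (nsformP phi)).

Lemma N1_neq0 : (-1 : F) != 0.
Proof. by rewrite oppr_eq0 oner_eq0. Qed.

Definition Wq_zero : Wq := wclass (mk_nsform (@nonsingular_zeroq0 F)).
Definition Wq_add (v w : Wq) : Wq := wclass (nsorth (wrepr v) (wrepr w)).
Definition Wq_scale (a : F) (a0 : a != 0) (w : Wq) : Wq :=
  wclass (nsscale a0 (wrepr w)).
Definition Wq_opp : Wq -> Wq := Wq_scale N1_neq0.

Lemma Wq_addE phi psi :
  Wq_add (wclass phi) (wclass psi) = wclass (nsorth phi psi).
Proof. by apply/wclassP; apply: witt_equiv_orth; exact: wreprP. Qed.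

Lemma Wq_scaleE a (a0 : a != 0) phi :
  Wq_scale a0 (wclass phi) = wclass (nsscale a0 phi).
Proof. by apply/wclassP; apply: witt_equiv_scale => //; exact: wreprP. Qed.

Lemma Wq_addA : associative Wq_add.
Proof.
move=> u v w; rewrite -(wreprK u) -(wreprK v) -(wreprK w) !Wq_addE.
by apply/wclassP; apply: witt_equiv_isom; exact: isom_orthA.
Qed.

Lemma Wq_addC : commutative Wq_add.
Proof.
by move=> u v; apply/wclassP; apply: witt_equiv_isom; exact: isom_orthC.
Qed.

Lemma Wq_add0 : left_id Wq_zero Wq_add.
Proof.
move=> u; rewrite Wq_addC -(wreprK u) Wq_addE.
by apply/wclassP; apply: witt_equiv_isom; exact: isom_orth0.
Qed.

Lemma Wq_addN : left_inverse Wq_zero Wq_opp Wq_add.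
Proof.
move=> u; rewrite Wq_addC -(wreprK u) /Wq_opp Wq_scaleE Wq_addE.
apply/wclassP; apply: witt_equiv_trans (witt_equiv_hyp F _).
by apply: witt_equiv_isom; apply: isom_orthN; exact: nsformP.
Qed.

HB.instance Definition _ :=
  GRing.isZmodule.Build Wq Wq_addA Wq_addC Wq_add0 Wq_addN.

End WittGroup.

Section WittExtension.
Variables (F K : fieldType) (f : {rmorphism F -> K}).

Definition nsmap (phi : nsform F) : nsform K :=
  mk_nsform (@nonsingular_map F K f _ (nsformP phi)).

Definition Wq_map (w : Wq F) : Wq K := wclass (nsmap (wrepr w)).

Lemma Wq_mapE phi : Wq_map (wclass phi) = wclass (nsmap phi).
Proof. by apply/wclassP; apply: witt_equiv_map; exact: wreprP. Qed.

Lemma Wq_mapD : {morph Wq_map : v w / v + w}.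
Proof.
move=> v w; rewrite -(wreprK v) -(wreprK w) [_ + _]Wq_addE !Wq_mapE.
rewrite [RHS]Wq_addE; congr wclass; apply: val_inj; exact: map_orth.
Qed.

(* W_q(K/F), where K is an extension of F via f. *)
Definition Wq_ker : set (Wq F) := [set w | Wq_map w = 0]%classic.

End WittExtension.

Section DiagonalForms.
Variable F : fieldType.

Definition nzelt : Type := {a : F | a != 0}.

Definition nz1 : nzelt := exist _ 1 (oner_neq0 F).

Definition nzmul (a b : nzelt) : nzelt :=
  exist _ (val a * val b) (mulf_neq0 (valP a) (valP b)).

(* <a_1, ..., a_n>_b, given by its entries. *)
Definition diag_bform : Type := seq nzelt.

Definition bdim (s : diag_bform) : nat := size s.

Definition bmx (s : diag_bform) : 'M[F]_(bdim s) :=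
  diag_mx (\row_i val (tnth (in_tuple s) i)).

Definition bval (s : diag_bform) (x y : 'rV[F]_(bdim s)) : F :=
  (x *m bmx s *m y^T) 0 0.

(* The totally singular form x |-> B(x, x). *)
Definition qform_of_bform (s : diag_bform) : qform F :=
  existT _ (bdim s) (bmx s).

Lemma qval_of_bform s (x : 'rV[F]_(bdim s)) :
  @qval F (qform_of_bform s) x = bval x x.
Proof. by []. Qed.

(* The product basis of the tensor product of two diagonal forms is again
   orthogonal, with the products of the entries as its values. *)
Definition btens (s t : diag_bform) : diag_bform :=
  [seq nzmul a b | a <- s, b <- t].

Definition pfister (s : seq nzelt) : diag_bform :=
  foldr (fun a B => btens [:: nz1; a] B) [:: nz1] s.

Definition Wq_act (s : diag_bform) (w : Wq F) : Wq F :=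
  \sum_(a <- s) Wq_scale (valP a) w.

End DiagonalForms.

Section FunctionField.
Variables (K L : fieldType) (j : {rmorphism K -> L}).

Definition qpoly (phi : qform K) : {mpoly K[qdim phi]} :=
  \sum_(u < qdim phi) \sum_(v < qdim phi)
     tagged phi u v *: ('X_u * 'X_v).

(* L, as an extension of K via j, is the function field of the reduced
   projective quadric phi = 0, assumed to be irreducible: L contains the
   homogeneous coordinates t of a point whose homogeneous vanishing ideal is
   the radical of (phi) (that is, a generic point), and every element of L is
   the value at t of a quotient of two forms of the same degree. *)
Definition quadric_function_field (phi : qform K) : Prop :=
  exists t : 'I_(qdim phi) -> L,
    [/\ exists u, t u != 0,
        forall d (p : {mpoly K[qdim phi]}), p \is d.-homog ->
          (mmap j t p = 0 <-> exists m g, p ^+ m = g * qpoly phi)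
      & forall x : L, exists d (p r : {mpoly K[qdim phi]}),
          [/\ p \is d.-homog, r \is d.-homog, mmap j t r != 0
            & x = mmap j t p / mmap j t r]].

End FunctionField.

(* Main.v *)
Require Import Defs.
From HB Require Import structures.
From mathcomp Require Import all_boot all_order all_algebra all_field.
From mathcomp Require Import boolp classical_sets.
From mathcomp Require Import ring zify mpoly.
Set Implicit Arguments.
Unset Strict Implicit.
Unset Printing Implicit Defensive.
Import GRing.Theory.
Local Open Scope ring_scope.

(* The proof replaces a form phi over F by a smaller one modulo W_q(K/F) and
   B_0 W_q(F). First, the anisotropic part of phi_K is again defined over F, as
   K^2 is contained in F. So let phi_K be anisotropic of positive dimension and
   hyperbolic over L. Then L embeds into E(sqrt u), where E = K(T_0, ..., T_{N-1})
   and u = sum_{i<N} (c_i / c_N) T_i^2 with c_0, ..., c_N the entries of B. If u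
   is a square (dim B_0 = 1) this is absurd, anisotropy being preserved by
   rational extensions. Otherwise a Lagrangian over E(sqrt u) is the graph of a
   similitude with factor u, so that, for each e in the space of phi, u phi(e) is
   represented over E by a vector orthogonal to e. The Cassels-Pfister theorem and
   specialization yield mutually orthogonal vectors over K with values d c_i,
   that is d B_0 lies in phi_K. One more vector, which can be given a value in
   F, shows that phi - B_0 [d, e] has, over K, an anisotropic part of dimension
   at most dim phi - 2, for some e in F. *)

(** * Totally isotropic subspaces *)

(** The overview treats the inclusion of W_q(L/F) in the right-hand side. For the converse when dim
    B_0 > 1, the isometry of q_K with q_0 plus a zero form carries the generic point in L to an
    isotropic vector of B_0 over L. It is nonzero because a linear form over K vanishing at the
    generic point has a power divisible by q_K. An isotropic Pfister form annihilates the Witt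
    group, by roundness.

    As q_K may be isotropic, L is not identified with a concrete field. An embedding suffices, since
    hyperbolicity passes to larger fields; so the target may come from the affine cone and have one
    more transcendental than L.

    The obstacle in descending from E to K is to keep the vectors found for the different T_i
    mutually orthogonal. Hence Cassels-Pfister is proved together with a matrix [C] of constant
    linear conditions, to which each vector found is added before the next variable is removed.

    Dimensions are compared through totally isotropic spaces. In phi - B_0 [d, e] one of dimension
    dim B_0 + 1 is found, which leaves dim phi + 2 dim B_0 - 2 (dim B_0 + 1) = dim phi - 2. *)

Lemma trmx11E (R : Type) (M : 'M[R]_1) : M^T 0 0 = M 0 0.
Proof. by rewrite mxE. Qed.

Section QuadraticValues.
Variables (R : comNzRingType) (n : nat) (A : 'M[R]_n).
Implicit Types x y z : 'rV[R]_n.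

(** Over a commutative ring, since the descent of Cassels and Pfister evaluates forms at polynomial
    vectors. *)
Definition qf x : R := (x *m A *m x^T) 0 0.
Definition bf x y : R := (x *m (A + A^T) *m y^T) 0 0.

Lemma bfDl x y z : bf (x + y) z = bf x z + bf y z.
Proof. by rewrite /bf !mulmxDl mxE. Qed.

Lemma bfDr x y z : bf x (y + z) = bf x y + bf x z.
Proof. by rewrite /bf [(y + z)^T]linearD /= mulmxDr mxE. Qed.

Lemma bfZl a x y : bf (a *: x) y = a * bf x y.
Proof. by rewrite /bf -!scalemxAl mxE. Qed.

Lemma bfZr a x y : bf x (a *: y) = a * bf x y.
Proof. by rewrite /bf [(a *: y)^T]linearZ /= -scalemxAr mxE. Qed.

Lemma bfC x y : bf x y = bf y x.
Proof.
rewrite /bf -[LHS]trmx11E.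
have -> : (x *m (A + A^T) *m y^T)^T = y *m (A + A^T) *m x^T; last by [].
by rewrite !trmx_mul trmxK [(A + A^T)^T]linearD /= trmxK [A^T + _]addrC mulmxA.
Qed.

Lemma bfxx x : bf x x = qf x + qf x.
Proof.
rewrite /bf mulmxDr mulmxDl mxE; congr (_ + _).
rewrite -[LHS]trmx11E.
have -> : (x *m A^T *m x^T)^T = x *m A *m x^T; last by [].
by rewrite !trmx_mul !trmxK mulmxA.
Qed.

Lemma qfD x y : qf (x + y) = qf x + qf y + bf x y.
Proof.
have -> : bf x y = (x *m A *m y^T) 0 0 + (y *m A *m x^T) 0 0.
  rewrite /bf mulmxDr mulmxDl mxE; congr (_ + _).
  rewrite -[LHS]trmx11E.
  have -> : (x *m A^T *m y^T)^T = y *m A *m x^T; last by [].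
  by rewrite !trmx_mul !trmxK mulmxA.
rewrite /qf [(x + y)^T]linearD /= !mulmxDl !mulmxDr.
set a := x *m _ *m _; set b := x *m _ *m _.
set c := y *m _ *m _; set d := y *m _ *m _.
have E (M N : 'M[R]_1) : (M + N) 0 0 = M 0 0 + N 0 0 by rewrite mxE.
by rewrite !E; ring.
Qed.

Lemma bfE x y : bf x y = qf (x + y) - qf x - qf y.
Proof. by rewrite qfD; ring. Qed.

Lemma qfZ a x : qf (a *: x) = a ^+ 2 * qf x.
Proof. by rewrite /qf [(a *: x)^T]linearZ /= -!scalemxAl -scalemxAr !mxE mulrA. Qed.

Lemma qf0 : qf 0 = 0.
Proof. by rewrite /qf !mul0mx mxE. Qed.

Lemma bf0l x : bf 0 x = 0.
Proof. by rewrite /bf !mul0mx mxE. Qed.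

Lemma bf0r x : bf x 0 = 0.
Proof. by rewrite bfC bf0l. Qed.

End QuadraticValues.

Lemma map_qf (R S : comNzRingType) (f : {rmorphism R -> S}) n (A : 'M[R]_n) x :
  qf (map_mx f A) (map_mx f x) = f (qf A x).
Proof. by rewrite /qf map_trmx -!map_mxM mxE. Qed.

Lemma map_bf (R S : comNzRingType) (f : {rmorphism R -> S}) n (A : 'M[R]_n) x y :
  bf (map_mx f A) (map_mx f x) (map_mx f y) = f (bf A x y).
Proof. by rewrite /bf !map_trmx -map_mxD -!map_mxM mxE. Qed.

Lemma qf_mul (R : comNzRingType) m n (A : 'M[R]_n) (P : 'M_(m, n)) (x : 'rV_m) :
  qf A (x *m P) = qf (P *m A *m P^T) x.
Proof. by rewrite /qf trmx_mul !mulmxA. Qed.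

Definition aniso (F : fieldType) n (A : 'M[F]_n) : Prop :=
  forall x, qf A x = 0 -> x = 0.

Section FormTheory.
Variable F : fieldType.
Implicit Types phi psi : qform F.

Lemma nonsingular_bf phi : nonsingular phi <->
  forall x, (forall y, bf (tagged phi) x y = 0) -> x = 0.
Proof.
by split=> h x x0; apply: h => y; [rewrite polarE; exact: x0 | rewrite /bf -polarE].
Qed.

Lemma isometric_mx phi psi (G : 'M[F]_(qdim phi, qdim psi)) :
  row_free G -> (qdim psi <= qdim phi)%N ->
  (forall x : 'rV_(qdim phi), qf (tagged psi) (x *m G) = qf (tagged phi) x) ->
  isometric phi psi.
Proof.
move=> fG le_d qG.
have fullG : row_full G.
  by rewrite /row_full eqn_leq rank_leq_col /= (eqP fG).
exists (fun x : 'rV_(qdim phi) => x *m G); split=> //.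
- by move=> a x y; rewrite mulmxDl scalemxAl.
- exists (fun y : 'rV_(qdim psi) => y *m pinvmx G) => x.
  + by apply: (row_free_inj fG); rewrite mulmxKpV ?submxMl.
  + by rewrite mulmxKpV // submx_full.
Qed.

Lemma isometric_mxP phi psi : isometric phi psi ->
  exists G : 'M[F]_(qdim phi, qdim psi), row_free G /\
  forall x : 'rV_(qdim phi), qf (tagged psi) (x *m G) = qf (tagged phi) x.
Proof.
move=> [f [lf bf_ qf_]]; have [G fG] := linear_mx lf; exists G; split; last first.
  by move=> x; have := qf_ x; rewrite fG.
rewrite -kermx_eq0; apply/eqP/row_matrixP => i; rewrite row0.
apply: (bij_inj bf_); rewrite !fG mul0mx.
by rewrite -row_mul mulmx_ker row0.
Qed.

Lemma isometric_dim phi psi : isometric phi psi -> qdim phi = qdim psi.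
Proof.
move=> h; have [G [/eqP fG _]] := isometric_mxP h.
have [H [/eqP fH _]] := isometric_mxP (isom_sym h).
by apply/eqP; rewrite eqn_leq -{1}fG rank_leq_col -{1}fH rank_leq_col.
Qed.

(** The rows of [U] are a basis of a totally isotropic space. Such spaces replace the Witt index: a
    Witt equivalence transports them with a controlled loss of dimension. *)
Definition has_isot phi r : Prop :=
  exists U : 'M[F]_(r, qdim phi), row_free U /\
    forall z, qf (tagged phi) (z *m U) = 0.

Lemma isot0 phi : has_isot phi 0.
Proof.
exists 0; split; first by rewrite /row_free mxrank0.
by move=> z; rewrite mulmx0 qf0.
Qed.

Lemma isot_isom phi psi r : isometric phi psi -> has_isot phi r -> has_isot psi r.
Proof.
move=> h [U [fU qU]]; have [G [fG qG]] := isometric_mxP h.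
exists (U *m G); split; first by rewrite /row_free mxrankMfree.
by move=> z; rewrite mulmxA qG qU.
Qed.

Lemma qf_orth phi psi x y :
  qf (tagged (orth phi psi)) (row_mx x y) = qf (tagged phi) x + qf (tagged psi) y.
Proof. exact: qval_orth. Qed.

Lemma qf_hyp r (x y : 'rV[F]_r) :
  qf (tagged (hyp F r)) (row_mx x y) = (x *m y^T) 0 0.
Proof. exact: qval_hyp. Qed.

Lemma bf_orth phi psi x y x' y' :
  bf (tagged (orth phi psi)) (row_mx x y) (row_mx x' y') =
  bf (tagged phi) x x' + bf (tagged psi) y y'.
Proof.
by rewrite !bfE add_row_mx !qf_orth; ring.
Qed.

Lemma bf_hyp r (x y x' y' : 'rV[F]_r) :
  bf (tagged (hyp F r)) (row_mx x y) (row_mx x' y') =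
  (x *m y'^T) 0 0 + (x' *m y^T) 0 0.
Proof.
rewrite !bfE add_row_mx !qf_hyp [(_ + _)^T]linearD /= mulmxDl !mulmxDr.
have E (M N : 'M[F]_1) : (M + N) 0 0 = M 0 0 + N 0 0 by rewrite mxE.
by rewrite !E; ring.
Qed.

Lemma isot_orth phi psi r s : has_isot phi r -> has_isot psi s ->
  has_isot (orth phi psi) (r + s).
Proof.
move=> [U [fU qU]] [V [fV qV]].
exists (block_mx U 0 0 V); split.
  by rewrite /row_free rank_diag_block_mx (eqP fU) (eqP fV).
move=> z; rewrite -[z]hsubmxK mul_row_block !mulmx0 addr0 add0r.
by rewrite qf_orth qU qV addr0.
Qed.

Lemma isot_hyp r : has_isot (hyp F r) r.
Proof.
exists (row_mx 1%:M 0); split.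
  apply/row_freeP; exists (col_mx 1%:M 0).
  by rewrite mul_row_col mulmx1 mul0mx addr0.
move=> z; rewrite mul_mx_row mulmx1 mulmx0 qf_hyp.
by rewrite trmx0 mulmx0 mxE.
Qed.

Lemma isot_polar n r (A : 'M[F]_n) (U : 'M[F]_(r, n)) :
  (forall z, qf A (z *m U) = 0) -> forall y z, bf A (y *m U) (z *m U) = 0.
Proof.
move=> qU y z; have := qU (y + z).
by rewrite mulmxDl qfD !qU !add0r.
Qed.

(* With Z the combinations of the rows having zero last component, the first
   components of Z still span a totally isotropic space; those killed by the
   first projection live in the left kernel of the last component. *)
Lemma isot_cancel phi r s : has_isot (orth phi (hyp F r)) s -> has_isot phi (s - r).
Proof.
move=> [U [fU qU]].
pose U0 := lsubmx U; pose U1 := lsubmx (rsubmx U); pose U2 := rsubmx (rsubmx U).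
have UE : U = row_mx U0 (row_mx U1 U2) by rewrite !hsubmxK.
pose Z := kermx U2.
have ZU z : z *m Z *m U = row_mx (z *m Z *m U0) (row_mx (z *m Z *m U1) 0).
  by rewrite UE !mul_mx_row -[z *m Z *m U2]mulmxA mulmx_ker mulmx0.
have qZ z : qf (tagged phi) (z *m (Z *m U0)) = 0.
  have := qU (z *m Z); rewrite ZU qf_orth qf_hyp trmx0 mulmx0 [in X in _ + X]mxE.
  by rewrite addr0 mulmxA.
have le_rk : (s - r <= \rank (Z *m U0))%N.
  pose Y := (Z :&: kermx U0)%MS.
  have YU0 : Y *m U0 = 0 by apply/sub_kermxP; exact: capmxSr.
  have YU2 : Y *m U2 = 0 by apply/sub_kermxP; exact: capmxSl.
  have rkY : \rank (Y *m U1) = \rank Y.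
    have -> : \rank Y = \rank (Y *m U) by rewrite mxrankMfree.
    rewrite UE !mul_mx_row YU0 YU2.
    apply/eqP; rewrite eqn_leq; apply/andP; split.
      have {1}-> : Y *m U1 = row_mx (0 : 'M_(_, qdim phi)) (row_mx (Y *m U1) (0 : 'M_(_, r)))
         *m col_mx 0 (col_mx 1%:M 0).
        by rewrite !mul_row_col mulmx1 !mul0mx addr0 add0r.
      exact: mxrankM_maxl.
    have -> : row_mx (0 : 'M_(_, qdim phi)) (row_mx (Y *m U1) (0 : 'M_(_, r))) =
        (Y *m U1) *m row_mx 0 (row_mx 1%:M 0).
      by rewrite !mul_mx_row !mulmx0 mulmx1.
    exact: mxrankM_maxl.
  (* The rows of [Y *m U] have only a middle component, so their pairing with the rows of [U] is
     this product. Its vanishing bounds the sum of the ranks of [Y] and [U2] by r. *)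
  have YU12 : Y *m U1 *m U2^T = 0.
    apply/matrixP => i k; rewrite [RHS]mxE.
    have := isot_polar qU (row i Y) (delta_mx 0 k).
    rewrite UE !mul_mx_row -!row_mul YU0 YU2 !row0 bf_orth bf0l add0r bf_hyp.
    rewrite trmx0 mulmx0 [X in _ + X]mxE addr0 -rowE => <-.
    rewrite !mxE; apply: eq_bigr => l _.
    by rewrite !mxE.
  have := mulmx0_rank_max YU12; rewrite rkY mxrank_tr => le1.
  have rkZ : \rank Z = (s - \rank U2)%N by rewrite mxrank_ker.
  have := mxrank_mul_ker Z U0; rewrite rkZ -/Y.
  by have := rank_leq_row U2; lia.
exists (pid_mx (s - r) *m row_base (Z *m U0)); split.
  rewrite /row_free mxrankMfree ?row_base_free // rank_pid_mx //.
move=> z; rewrite mulmxA.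
have /submxP[w ->] : (z *m pid_mx (s - r) *m row_base (Z *m U0) <= Z *m U0)%MS.
  by apply: submx_trans (submxMl _ _) _; rewrite eq_row_base.
exact: qZ.
Qed.

Lemma witt_isot phi psi r s : isometric (orth phi (hyp F r)) (orth psi (hyp F s)) ->
  forall k, has_isot phi k -> has_isot psi (k + r - s).
Proof.
move=> h k ik; apply: isot_cancel; apply: isot_isom h _.
exact: isot_orth ik (isot_hyp r).
Qed.

Lemma aniso_isot phi r : aniso (tagged phi) -> has_isot phi r -> r = 0%N.
Proof.
move=> an [U [fU qU]]; case: r U fU qU => // r U fU qU; exfalso.
have := an _ (qU (delta_mx 0 0)).
move/(congr1 (mulmx^~ (pinvmx U))); rewrite mulmxKp // mul0mx.
by move/matrixP/(_ 0 0)/eqP; rewrite !mxE !eqxx oner_eq0.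
Qed.

(** The image of the k-dimensional space in the anisotropic [psi] must be 0, so k + r <= s; the
    dimensions of the two isometric sums then give the bound. The final induction on the dimension
    rests on it. *)
Lemma witt_aniso_dim phi psi k : witt_equiv phi psi -> aniso (tagged psi) ->
  has_isot phi k -> (qdim psi + k + k <= qdim phi)%N.
Proof.
move=> [r [s h]] an ik; have e1 := aniso_isot an (witt_isot h ik).
have e2 : (qdim phi + (r + r) = qdim psi + (s + s))%N := isometric_dim h.
by lia.
Qed.

Lemma witt_zero_lagrangian phi : witt_equiv phi (Defs.zeroq F 0) ->
  exists2 m, qdim phi = (m + m)%N & has_isot phi m.
Proof.
move=> [r [s h]]; have e : (qdim phi + (r + r) = s + s)%N := isometric_dim h.
exists (s - r)%N; first by lia.
by have := witt_isot (isom_sym h) (isot0 _); rewrite add0n.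
Qed.

End FormTheory.

(** * The Cassels-Pfister theorem *)

Lemma qfE (R : comNzRingType) n (A : 'M[R]_n) x :
  qf A x = \sum_i \sum_j x 0 i * A i j * x 0 j.
Proof.
rewrite /qf mxE exchange_big; apply: eq_bigr => j _ /=.
by rewrite !mxE mulr_suml.
Qed.

Lemma coefM_top (R : nzSemiRingType) (p q : {poly R}) m :
  (size p <= m.+1)%N -> (size q <= m.+1)%N -> (p * q)`_(m + m) = p`_m * q`_m.
Proof.
move=> sp sq; have lt_m : (m < (m + m).+1)%N by lia.
rewrite coefM (bigD1 (Ordinal lt_m)) //= addnK big1 ?addr0 // => i.
rewrite -val_eqE /= => ne_im; have [lt_im|le_mi] := ltnP i m.
  by rewrite [q`__]nth_default ?mulr0 //; apply: leq_trans sq _; lia.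
by rewrite [p`__]nth_default ?mul0r //; apply: leq_trans sp _; lia.
Qed.

Lemma ratio_numden (R : idomainType) (a : {fraction R}) :
  exists nd : R * R, nd.2 != 0 /\ a * (tofrac nd.2) = tofrac nd.1.
Proof.
pose r := repr a; exists (\n_r, \d_r); split; first exact: denom_ratioP.
have -> : a = \pi_({fraction R})%qT r by rewrite reprK.
rewrite /=; unlock tofrac; rewrite -[LHS]FracField.pi_mul.
apply/eqP; rewrite FracField.equivf_def /FracField.mulf /=.
rewrite !numden_Ratio ?mulr1 ?oner_neq0 ?denom_ratioP //.
by rewrite mulrC.
Qed.

Lemma common_denominator (R : idomainType) n (v : 'rV[{fraction R}]_n) :
  exists2 g : R, g != 0 & exists x : 'rV_n, map_mx (@tofrac R) x = tofrac g *: v.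
Proof.
have [nd ndP] := choice (@ratio_numden R).
exists (\prod_i (nd (v 0 i)).2).
  by apply/prodf_neq0 => i _; case: (ndP (v 0 i)).
exists (\row_i ((nd (v 0 i)).1 * \prod_(j | j != i) (nd (v 0 j)).2)).
apply/rowP => i; rewrite !mxE [in RHS](bigD1 i) //= !tofracM -(ndP (v 0 i)).2.
by ring.
Qed.

Section CasselsPfister.
Variables (E : fieldType) (n l : nat) (A : 'M[E]_n) (C : 'M[E]_(n, l)).
Hypothesis char2 : (2 \in [pchar E])%N.
Hypothesis anA : aniso A.
Local Notation AX := (map_mx (@polyC E) A).
Local Notation CX := (map_mx (@polyC E) C).
Implicit Types x y : 'rV[{poly E}]_n.

Let char2X : (2 \in [pchar {poly E}])%N.
Proof. exact: (rmorph_pchar (@polyC E)) char2. Qed.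

Definition coefv x k : 'rV[E]_n := map_mx (coefp k) x.

Lemma qf_poly_size x m : (forall i, size (x 0%R i) <= m.+1)%N ->
  (size (qf AX x) <= (m + m).+1)%N.
Proof.
move=> sx; rewrite qfE; apply: leq_trans (size_sum _ _ _) _; apply/bigmax_leqP => i _.
apply: leq_trans (size_sum _ _ _) _; apply/bigmax_leqP => j _.
rewrite [map_mx _ _ i j]mxE mulrAC [_ * _%:P]mulrC mul_polyC.
apply: leq_trans (size_scale_leq _ _) _; apply: leq_trans (size_polyMleq _ _) _.
by move: (sx i) (sx j); set a := size _; set b := size _; lia.
Qed.

Lemma qf_poly_top x m : (forall i, size (x 0%R i) <= m.+1)%N ->
  (qf AX x)`_(m + m) = qf A (coefv x m).
Proof.
move=> sx; rewrite !qfE coef_sum; apply: eq_bigr => i _.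
rewrite coef_sum; apply: eq_bigr => j _.
rewrite !mxE coefM_top //; first by rewrite coefMC.
by rewrite mulrC mul_polyC; apply: leq_trans (size_scale_leq _ _) _.
Qed.

(** Leading terms cannot cancel: if M is too large for the degree of the value, the vector of
    coefficients of degree M is isotropic, hence 0, and the bound M drops by one. *)
Lemma aniso_poly_size x d : (size (qf AX x) <= d + d)%N ->
  forall i, (size (x 0%R i) <= d)%N.
Proof.
move=> sq; have [M sM] : exists M, forall i, (size (x 0%R i) <= M)%N.
  by exists (\max_i size (x 0%R i)) => i; apply: (leq_bigmax i).
elim: M sM => [|M IH] sM; first by move=> i; apply: leq_trans (sM i) _.
have [le_dM|lt_Md] := leqP d M; last by move=> i; apply: leq_trans (sM i) lt_Md.
apply: IH => i; apply/leq_sizeP => k le_Mk.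
have [<-|ne_kM] := eqVneq M k; last first.
  by rewrite nth_default //; apply: leq_trans (sM i) _; rewrite ltn_neqAle ne_kM.
have /matrixP/(_ 0 i) : coefv x M = 0; last by rewrite !mxE.
apply: anA; rewrite -qf_poly_top // nth_default //.
by apply: leq_trans sq _; rewrite leq_add.
Qed.

Lemma aniso_poly x : qf AX x = 0 -> x = 0.
Proof.
move=> q0; apply/rowP => i; rewrite mxE; apply/eqP; rewrite -size_poly_leq0.
by apply: (@aniso_poly_size x 0); rewrite q0 size_poly0.
Qed.

(* The denominator g is replaced by g', of smaller degree since g * g' is the
   value of the form at the remainder r of x by g: geometrically, x' / g' is
   the second intersection of the quadric with the line through x / g and y. *)
Lemma cassels_pfister p g x : g != 0 -> qf AX x = p * g ^+ 2 -> x *m CX = 0 ->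
  exists2 y, qf AX y = p & y *m CX = 0.
Proof.
have [m] := ubnP (size g); elim: m g x => // m IH g x lt_gm g0 qx cx.
pose y : 'rV_n := map_mx (fun q => q %/ g) x.
pose r : 'rV_n := map_mx (fun q => q %% g) x.
have xE : x = g *: y + r by apply/rowP => i; rewrite !mxE mulrC -divp_eq.
have rE : r = x + g *: y.
  by apply/rowP => i; rewrite xE !mxE addrAC addrr_pchar2 // add0r.
(* The conditions have constant coefficients, so they commute with taking quotients by g. *)
have cy : y *m CX = 0.
  apply/rowP => k; have /rowP/(_ k) := cx; rewrite !mxE.
  move=> ck; transitivity ((\sum_j x 0 j * CX j k) %/ g); last by rewrite ck div0p.
  rewrite (big_morph _ (fun a b => divpD g a b) (div0p g)).
  apply: eq_bigr => i _; rewrite !mxE ![_ * _%:P]mulrC !mul_polyC.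
  by rewrite divpZl.
have [r0|r_neq0] := eqVneq r 0.
  exists y => //; apply: (mulIf (expf_neq0 2 g0)).
  by rewrite -qx xE r0 addr0 qfZ mulrC.
pose g' := g * (p + qf AX y) + bf AX x y.
have gg' : qf AX r = g * g'.
  by rewrite rE qfD qfZ bfZr qx /g'; ring.
have g'0 : g' != 0.
  by apply: contra_neq r_neq0 => g'0; apply: aniso_poly; rewrite gg' g'0 mulr0.
apply: (IH g' ((qf AX y + p) *: x + bf AX x y *: y)) => //.
- have sg : (0 < size g)%N by rewrite size_poly_gt0.
  have sr i : (size (r 0%R i) < size g)%N by rewrite mxE ltn_modp.
  have [k sgk] : exists k, size g = k.+2.
    case sgE : (size g) sg sr => [|[|k]] // _ sr; last by exists k.
    case/negP: r_neq0; apply/eqP/rowP => i; rewrite [RHS]mxE; apply/eqP.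
    by rewrite -size_poly_leq0 -ltnS.
  have : (size (qf AX r) <= (k + k).+1)%N.
    by apply: qf_poly_size => i; rewrite -ltnS -sgk.
  rewrite gg' size_mul // sgk /= => sg'.
  by move: lt_gm sg'; rewrite sgk; set s := size g'; lia.
- rewrite qfD !qfZ bfZl bfZr qx /g'; set b := bf _ _ _; set q := qf _ _.
  have e : 2%:R = 0 :> {poly E} by apply: pcharf0.
  have -> : (q + p) ^+ 2 * (p * g ^+ 2) + b ^+ 2 * q + (q + p) * (b * b) =
    p * (g * (p + q) + b) ^+ 2 + 2%:R * (b ^+ 2 * q - p * g * (p + q) * b) by ring.
  by rewrite e mul0r addr0.
- by rewrite mulmxDl -!scalemxAl cx cy !scaler0 addr0.
Qed.

End CasselsPfister.

(** * Iterated rational function fields *)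

Definition toratf (E : fieldType) : {rmorphism E -> {fraction {poly E}}} :=
  @tofrac {poly E} \o @polyC E.

(** The variables are adjoined one at a time because the theorem of Cassels and Pfister handles a
    single variable. *)
Fixpoint ratf (K : fieldType) (r : nat) : fieldType :=
  if r is r'.+1 then {fraction {poly (ratf K r')}} : fieldType else K.

Fixpoint ratC (K : fieldType) (r : nat) : {rmorphism K -> ratf K r} :=
  match r with
  | 0 => idfun
  | r'.+1 => (toratf (ratf K r') \o ratC K r')
  end.

(** The variable T_i for i < r, and the default 0 for i >= r. *)
Fixpoint ratX (K : fieldType) (r : nat) : nat -> ratf K r :=
  match r with
  | 0 => fun _ => 0
  | r'.+1 => fun i => if i == r' then tofrac 'X else toratf (ratf K r') (ratX K r' i)
  end.

Section RationalStep.
Variables (E : fieldType) (n : nat) (A : 'M[E]_n).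
Hypothesis char2 : (2 \in [pchar E])%N.
Hypothesis anA : aniso A.
Local Notation AF := (map_mx (toratf E) A).

Lemma map_toratf m k (M : 'M[E]_(m, k)) :
  map_mx (toratf E) M = map_mx (@tofrac {poly E}) (map_mx (@polyC E) M).
Proof. by rewrite -map_mx_comp. Qed.

Lemma aniso_rational : aniso AF.
Proof.
move=> v q0; have [g g0 [x xE]] := common_denominator v.
have x0 : x = 0.
  apply: (aniso_poly anA); apply/eqP; rewrite -tofrac_eq0; apply/eqP.
  by rewrite -map_qf -map_toratf xE qfZ q0 mulr0.
have /eqP : tofrac g *: v = 0 by rewrite -xE x0 map_mx0.
by rewrite scaler_eq0 tofrac_eq0 (negPf g0) => /eqP.
Qed.

(** Cassels-Pfister makes the vector polynomial, and anisotropy bounds its degree by 1. The value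
    has no linear term, which makes the two coefficient vectors orthogonal. *)
Lemma represented_quadratic l (C : 'M[E]_(n, l)) (c0 c2 : E) (v : 'rV_n) :
  qf AF v = toratf E c0 + toratf E c2 * tofrac 'X ^+ 2 ->
  v *m map_mx (toratf E) C = 0 ->
  exists v0 v1 : 'rV[E]_n, [/\ qf A v0 = c0, qf A v1 = c2, bf A v0 v1 = 0,
                              v0 *m C = 0 & v1 *m C = 0].
Proof.
move=> qv cv; have [g g0 [x xE]] := common_denominator v.
have qx : qf (map_mx (@polyC E) A) x = (c0%:P + c2%:P * 'X^2) * g ^+ 2.
  apply/eqP; rewrite -tofrac_eq; apply/eqP.
  rewrite -map_qf -map_toratf xE qfZ qv /= !tofracM tofracD tofracM !expr2 !tofracM.
  by ring.
have cx : x *m map_mx (@polyC E) C = 0.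
  apply/matrixP => i j; rewrite [RHS]mxE; apply/eqP; rewrite -tofrac_eq0; apply/eqP.
  have /matrixP/(_ i j) : map_mx (@tofrac {poly E}) (x *m map_mx (@polyC E) C) = 0.
    by rewrite map_mxM -map_toratf xE -scalemxAl cv scaler0.
  by rewrite mxE [RHS]mxE.
have [y qy cy] := cassels_pfister char2 anA g0 qx cx.
have sy i : (size (y 0%R i) <= 2)%N.
  apply: aniso_poly_size anA _ _ _ i; rewrite qy.
  apply: leq_trans (size_polyD _ _) _; rewrite geq_max; apply/andP; split.
    by apply: leq_trans (size_polyC_leq1 _) _.
  by rewrite mul_polyC; apply: leq_trans (size_scale_leq _ _) _; rewrite size_polyXn.
pose v0 := coefv y 0; pose v1 := coefv y 1.
have yE : y = map_mx (@polyC E) v0 + 'X *: map_mx (@polyC E) v1.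
  apply/rowP => i; apply/polyP => k.
  rewrite !mxE coefD coefXM !coefC /=.
  case: k => [|[|k]] /=; rewrite ?addr0 ?add0r //.
  by rewrite nth_default //; apply: leq_trans (sy i) _.
have qE : (qf A v0)%:P + 'X^2 * (qf A v1)%:P + 'X * (bf A v0 v1)%:P =
          c0%:P + c2%:P * 'X^2.
  by rewrite -qy [in RHS]yE qfD qfZ bfZr !map_qf map_bf.
have co k (M : 'rV[E]_n) : M = coefv y k -> M *m C = 0.
  move=> ->; apply/rowP => j; rewrite [RHS]mxE.
  transitivity (((y *m map_mx (@polyC E) C) 0 j)`_k); last by rewrite cy mxE coef0.
  by rewrite !mxE coef_sum; apply: eq_bigr => i _; rewrite !mxE coefMC.
exists v0, v1; split; try exact: co.
- move/(congr1 (coefp 0)): qE => /=.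
  by rewrite !(coefD, coefXnM, coefXM, coefCM, coefXn, coefC) /= ?mulr0 ?mulr1 ?addr0 ?add0r.
- move/(congr1 (coefp 2)): qE => /=.
  by rewrite !(coefD, coefXnM, coefXM, coefCM, coefXn, coefC) /= ?mulr0 ?mulr1 ?addr0 ?add0r.
- move/(congr1 (coefp 1)): qE => /=.
  by rewrite !(coefD, coefXnM, coefXM, coefCM, coefXn, coefC) /= ?mulr0 ?mulr1 ?addr0 ?add0r.
Qed.

End RationalStep.

(** * Descent of orthogonal vectors through rational function fields *)

Section Subforms.
Variables (K : fieldType) (n : nat) (A : 'M[K]_n).
Hypothesis char2 : (2 \in [pchar K])%N.
Hypothesis anA : aniso A.
Local Notation AK r := (map_mx (ratC K r) A).

Lemma pchar_ratf r : (2 \in [pchar (ratf K r)])%N.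
Proof. exact: (rmorph_pchar (ratC K r)) char2. Qed.

Lemma map_ratCS r m k (M : 'M[K]_(m, k)) :
  map_mx (ratC K r.+1) M = map_mx (toratf _) (map_mx (ratC K r) M).
Proof. by apply/matrixP => i j; rewrite !mxE. Qed.

Lemma aniso_ratf r : aniso (AK r).
Proof.
elim: r => [|r IH]; first by rewrite map_mx_id.
by rewrite map_ratCS; apply: aniso_rational.
Qed.

(** A constant is the case c2 = 0 of the one-variable step, whose vector [v0] lives one level
    lower. *)
Lemma represented_constant r l (C : 'M[K]_(n, l)) c (v : 'rV_n) :
  qf (AK r) v = ratC K r c -> v *m map_mx (ratC K r) C = 0 ->
  exists2 w : 'rV[K]_n, qf A w = c & w *m C = 0.
Proof.
elim: r v => [|r IH] v; first by rewrite !map_mx_id // => *; exists v.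
rewrite !map_ratCS => qv cv.
have {}qv : qf (map_mx (toratf _) (AK r)) v =
    toratf _ (ratC K r c) + toratf _ 0 * tofrac 'X ^+ 2.
  by rewrite qv rmorph0 mul0r addr0.
have [v0 [v1 [q0 _ _ c0 _]]] :=
  represented_quadratic (pchar_ratf r) (aniso_ratf (r := r)) qv cv.
exact: IH q0 c0.
Qed.

(* The reflection along v1 + w exchanges v1 and w; it exists unless v1 = w since
   qf (v1 + w) = bf v1 w in characteristic 2. *)
Lemma reflect_pair (E : fieldType) (M : 'M[E]_n) l (C : 'M[E]_(n, l))
    (v0 v1 w : 'rV[E]_n) : (2 \in [pchar E])%N -> aniso M ->
  qf M v1 = qf M w -> bf M v0 v1 = 0 ->
  v0 *m C = 0 -> v1 *m C = 0 -> w *m C = 0 ->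
  exists u, [/\ qf M u = qf M v0, bf M u w = 0 & u *m C = 0].
Proof.
move=> ch anM qvw b01 c0 c1 cw; pose z := v1 + w.
have qz : qf M z = bf M v1 w by rewrite qfD qvw addrr_pchar2 // add0r.
have [b0|b_neq0] := eqVneq (bf M v1 w) 0.
  have z0 : z = 0 by apply: anM; rewrite qz.
  have wE : w = v1.
    apply/rowP => i; have /rowP/(_ i) := z0; rewrite !mxE => /eqP.
    by rewrite addrC addr_eq0 oppr_pchar2 // => /eqP.
  by exists v0; rewrite wE.
have q_neq0 : qf M z != 0 by rewrite qz.
exists (v0 + (bf M v0 z / qf M z) *: z); split.
- rewrite qfD qfZ bfZr -addrA; set b := bf M v0 z.
  have -> : (b / qf M z) ^+ 2 * qf M z = b / qf M z * b.
    by have q0 : qf M z != 0 := q_neq0; field.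
  by rewrite addrr_pchar2 // addr0.
- have -> : bf M v0 z = bf M v0 w by rewrite bfDr b01 add0r.
  rewrite bfDl bfZl bfDl [bf M w w]bfxx addrr_pchar2 // addr0 -qz.
  by rewrite divfK // addrr_pchar2.
- by rewrite mulmxDl -scalemxAl mulmxDl c0 c1 cw !addr0 scaler0 addr0.
Qed.

(** Removing the last variable yields orthogonal [v0] and [v1], both still over a rational function
    field. The value of [v1] is a constant, so some [w] over K has the same value; a reflection
    moves [v0] to a vector [u] orthogonal to [w]. Orthogonality to [w], now a condition over K, is
    appended to [C], and the induction continues with [u]. *)
Lemma represented_diagonal r l (C : 'M[K]_(n, l)) (c : nat -> K) (v : 'rV_n) :
  qf (AK r) v = \sum_(i < r) ratC K r (c i) * ratX K r i ^+ 2 ->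
  v *m map_mx (ratC K r) C = 0 ->
  exists w : nat -> 'rV[K]_n, forall i, (i < r)%N ->
    [/\ qf A (w i) = c i, w i *m C = 0 & forall j, (j < i)%N -> bf A (w i) (w j) = 0].
Proof.
elim: r l C v => [|r IH] l C v; first by exists (fun _ => 0).
rewrite big_ord_recr /= eqxx !map_ratCS => qv cv.
have {}qv : qf (map_mx (toratf _) (AK r)) v =
    toratf _ (\sum_(i < r) ratC K r (c i) * ratX K r i ^+ 2) +
    toratf _ (ratC K r (c r)) * tofrac 'X ^+ 2.
  rewrite qv; congr (_ + _); rewrite rmorph_sum; apply: eq_bigr => i _.
  by rewrite ltn_eqF // rmorphM rmorphXn.
have [v0 [v1 [q0 q1 b01 c0 c1]]] :=
  represented_quadratic (pchar_ratf r) (aniso_ratf (r := r)) qv cv.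
have [w qw cw] := represented_constant q1 c1.
have [||u [qu bu cu]] := reflect_pair (w := map_mx (ratC K r) w)
  (pchar_ratf r) (aniso_ratf (r := r)) _ b01 c0 c1 _.
- by rewrite map_qf qw.
- by rewrite -map_mxM cw map_mx0.
have [||W WP] := IH _ (row_mx C ((A + A^T) *m w^T)) u.
- by rewrite qu.
- rewrite map_row_mx mul_mx_row cu map_mxM map_mxD mulmxA -!map_trmx.
  have -> : u *m (AK r + (AK r)^T) *m (map_mx (ratC K r) w)^T = 0.
    by apply/matrixP => i j; rewrite !ord1 [RHS]mxE.
  by rewrite row_mx0.
exists (fun i => if i == r then w else W i) => i; rewrite ltnS leq_eqVlt.
case/orP=> [/eqP ->|lt_ir].
  rewrite eqxx; split=> // j lt_jr; rewrite ltn_eqF //.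
  have [_ + _] := WP j lt_jr; rewrite mul_mx_row => /eqP.
  rewrite row_mx_eq0 => /andP[_ /eqP e].
  by rewrite bfC /bf -mulmxA e mxE.
rewrite (ltn_eqF lt_ir); have [qW cW bW] := WP i lt_ir; split=> //.
  by move/eqP: cW; rewrite mul_mx_row row_mx_eq0 => /andP[/eqP].
by move=> j lt_ji; rewrite ltn_eqF ?(ltn_trans lt_ji) //; exact: bW.
Qed.

End Subforms.

(** * Generic points of diagonal quadrics *)

Section MPolyUnivariate.
Variable (K : comNzRingType).

Lemma mpoly_rmorph_ext n (S : comNzRingType) (f g : {rmorphism {mpoly K[n]} -> S}) :
  (forall c, f c%:MP = g c%:MP) -> (forall i, f 'X_i = g 'X_i) -> f =1 g.
Proof.
move=> fgC fgX; elim/mpolyind => [|c m p _ _ IH]; first by rewrite !rmorph0.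
rewrite !rmorphD IH -mul_mpolyC !rmorphM fgC mpolyXE_id !rmorph_prod.
by congr (_ * _ + _); apply: eq_bigr => i _; rewrite !rmorphXn fgX.
Qed.

Lemma muni_Xmax n : muni ('X_ord_max : {mpoly K[n.+1]}) = 'X.
Proof.
rewrite muniE msuppX big_seq1 mcoeffX eqxx scale1r mnm1E eqxx.
rewrite (_ : [multinom _ | i < n] = 0%MM) ?mpolyX0 ?scale1r //.
by apply/mnmP => i; rewrite !mnmE; case: eqP => // /(congr1 val) /= e;
   have := ltn_ord i; rewrite -e ltnn.
Qed.

Lemma muni_Xwiden n (i : 'I_n) :
  muni ('X_(widen_ord (leqnSn n) i) : {mpoly K[n.+1]}) = ('X_i)%:P.
Proof.
rewrite muniE msuppX big_seq1 mcoeffX eqxx scale1r mnm1E.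
have -> : (widen_ord (leqnSn n) i == ord_max) = false.
  by apply/eqP => /(congr1 val) /= e; have := ltn_ord i; rewrite e ltnn.
rewrite expr0 -mul_polyC mulr1; congr ('X_[_])%:P.
by apply/mnmP => k; rewrite !mnmE.
Qed.

Definition of_uni n : {rmorphism {poly {mpoly K[n]}} -> {mpoly K[n.+1]}} :=
  horner_eval ('X_ord_max : {mpoly K[n.+1]}) \o map_poly (@mwiden n K).

Lemma ord_widen_max n (P : 'I_n.+1 -> Prop) :
  P ord_max -> (forall i : 'I_n, P (widen_ord (leqnSn n) i)) -> forall i, P i.
Proof.
move=> Pm Pw i; have [lt_in|le_ni] := ltnP i n.
  have -> : i = widen_ord (leqnSn n) (Ordinal lt_in) by exact: val_inj.
  exact: Pw.
by have -> : i = ord_max by apply/val_inj/anti_leq; rewrite le_ni -ltnS ltn_ord.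
Qed.

Lemma muniK n : cancel (@muni n K) (@of_uni n).
Proof.
move=> p; apply: (mpoly_rmorph_ext (f := @of_uni n \o @muni n K) (g := idfun)).
  by move=> c; rewrite /= muniC map_polyC /horner_eval hornerC /= mwidenC.
apply: ord_widen_max => [|i]; rewrite /= ?muni_Xmax ?muni_Xwiden.
  by rewrite map_polyX /horner_eval hornerX.
by rewrite map_polyC /horner_eval hornerC /= mwidenX mnmwiden1.
Qed.

Lemma mmap_muni n (S : comNzRingType) (f : {rmorphism K -> S}) (h : 'I_n.+1 -> S) p :
  mmap f h p =
  (map_poly (mmap f (fun i => h (widen_ord (leqnSn n) i))) (muni p)).[h ord_max].
Proof.
pose h' i := h (widen_ord (leqnSn n) i).
apply: (mpoly_rmorph_ext (f := mmap f h)
   (g := horner_eval (h ord_max) \o map_poly (mmap f h') \o @muni n K)) => [c|].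
  by rewrite /= muniC map_polyC /horner_eval hornerC /= !mmapC.
apply: ord_widen_max => [|i]; rewrite /= ?muni_Xmax ?muni_Xwiden mmapX mmap1U.
  by rewrite map_polyX /horner_eval hornerX.
by rewrite map_polyC /horner_eval hornerC /= mmapX mmap1U.
Qed.

End MPolyUnivariate.

Section AlgebraicIndependence.
Variable K : fieldType.

Definition mrat r : {rmorphism {mpoly K[r]} -> ratf K r} :=
  mmap (ratC K r) (fun i : 'I_r => ratX K r i).

Lemma mratC r c : mrat r c%:MP = ratC K r c.
Proof. exact: mmapC. Qed.

Lemma mratX r i : mrat r 'X_i = ratX K r i.
Proof. by rewrite /mrat /= mmapX mmap1U. Qed.

(** Algebraic independence of the T_i: with the last variable split off, [mrat] acts on the
    coefficients by the previous [mrat], and the last T is a polynomial indeterminate. *)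
Lemma mrat_eq0 r p : mrat r p = 0 -> p = 0.
Proof.
elim: r p => [|r IH] p.
  by rewrite [p]nvar0_mpolyC mratC /= => ->; rewrite mpolyC0.
rewrite [mrat _ _]mmap_muni.
pose h i := ratX K r.+1 (widen_ord (leqnSn r) i).
have e : mmap (ratC K r.+1) h =1 toratf _ \o mrat r.
  apply: (mpoly_rmorph_ext (f := mmap (ratC K r.+1) h) (g := toratf _ \o mrat r)).
    by move=> c; rewrite /= mmapC mratC.
  by move=> i; rewrite /= mmapX mmap1U mratX /h /= ltn_eqF.
rewrite (eq_map_poly e) /= eqxx.
rewrite (map_poly_comp (@tofrac _) (@polyC _ \o mrat r)).
rewrite horner_map (map_poly_comp (@polyC _) (mrat r)) => /eqP.
rewrite tofrac_eq0 -[horner _ _]/(_ \Po 'X) comp_polyXr => /eqP p0.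
apply: (can_inj (@muniK K r)); rewrite muni0; apply/polyP => k.
by rewrite coef0; apply: IH; rewrite -coef_map p0 coef0.
Qed.

End AlgebraicIndependence.

Section Specialization.
Variables (K L Om : fieldType) (j : {rmorphism K -> L}) (kap : {rmorphism K -> Om}).
Variables (phi : qform K) (s : 'I_(qdim phi) -> Om).
Hypothesis ff : quadric_function_field j phi.
Hypothesis qs : mmap kap s (Defs.qpoly phi) = 0.
Hypothesis gen_s : forall p, mmap kap s p = 0 -> exists m g, p ^+ m = g * Defs.qpoly phi.

(* Evaluation of quotients of forms at [t] and at [s] defines an embedding
   since the two points have the same vanishing ideal. *)
Lemma function_field_embed : exists D : {rmorphism L -> Om}, forall x, D (j x) = kap x.
Proof.
have [t [_ t_gen t_onto]] := ff.
have ts d p : p \is d.-homog -> mmap j t p = 0 -> mmap kap s p = 0.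
  move=> hp /(t_gen _ _ hp) [m [g e]].
  have /eqP : mmap kap s p ^+ m = 0 by rewrite -rmorphXn /= e rmorphM /= qs mulr0.
  by rewrite expf_eq0 => /andP[_ /eqP].
have st d p : p \is d.-homog -> mmap j t p != 0 -> mmap kap s p != 0.
  by move=> hp; apply: contra_neq => /gen_s/(t_gen _ _ hp).
(* An element of L has many expressions as a quotient of forms, so the embedding starts as a
   relation. It is single-valued because it respects differences and relates 0 only to 0. *)
pose Rel x y := exists d (p r : {mpoly K[qdim phi]}),
  [/\ p \is d.-homog, r \is d.-homog, mmap j t r != 0,
      x = mmap j t p / mmap j t r & y = mmap kap s p / mmap kap s r].
have Rel_ex x : exists y, Rel x y.
  have [d [p [r [hp hr r0 xE]]]] := t_onto x.
  by exists (mmap kap s p / mmap kap s r), d, p, r.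
have Rel0 y : Rel 0 y -> y = 0.
  move=> [d [p [r [hp hr r0 /esym/eqP + ->]]]].
  rewrite mulf_eq0 invr_eq0 (negPf r0) orbF => /eqP /(ts _ _ hp) ->.
  by rewrite mul0r.
have RelM x y x' y' : Rel x y -> Rel x' y' -> Rel (x * x') (y * y').
  move=> [d [p [r [hp hr r0 -> ->]]]] [d' [p' [r' [hp' hr' r0' -> ->]]]].
  exists (d + d')%N, (p * p'), (r * r'); rewrite !rmorphM /= mulf_neq0 //.
  by split; rewrite ?dhomogM ?invfM //; ring.
have RelB x y x' y' : Rel x y -> Rel x' y' -> Rel (x - x') (y - y').
  move=> [d [p [r [hp hr r0 -> ->]]]] [d' [p' [r' [hp' hr' r0' -> ->]]]].
  exists (d + d')%N, (p * r' - p' * r), (r * r').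
  have sr0 := st _ _ hr r0; have sr0' := st _ _ hr' r0'.
  rewrite !rmorphB !rmorphM /= mulf_neq0 //.
  split; rewrite ?dhomogM //; last by field; rewrite sr0 sr0'.
    by apply: rpredB; [apply: dhomogM | rewrite addnC; apply: dhomogM].
  by field; rewrite r0 r0'.
have Rel_j x : Rel (j x) (kap x).
  exists 0%N, x%:MP, 1; rewrite !rmorph1 /= !mmapC !divr1 oner_neq0; split=> //.
    by rewrite -[x%:MP]mulr1 mul_mpolyC rpredZ ?dhomog1.
  exact: dhomog1.
have Rel_fun x y y' : Rel x y -> Rel x y' -> y = y'.
  move=> h h'; apply/eqP; rewrite -subr_eq0; apply/eqP/Rel0.
  by rewrite -(subrr x); apply: RelB.
have [D DP] := choice Rel_ex.
have Dadd : zmod_morphism D by move=> x y; apply: Rel_fun (DP _) (RelB _ _ _ _ (DP x) (DP y)).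
have Dmul : monoid_morphism D.
  split; last by move=> x y; apply: Rel_fun (DP _) (RelM _ _ _ _ (DP x) (DP y)).
  by apply: Rel_fun (DP _) _; rewrite -(rmorph1 j) -(rmorph1 kap).
pose DA := GRing.isZmodMorphism.Build L Om D Dadd.
pose DM := GRing.isMonoidMorphism.Build L Om D Dmul.
pose DR : {rmorphism L -> Om} := HB.pack D DA DM.
by exists DR => x; apply: Rel_fun (DP _) (Rel_j x).
Qed.

End Specialization.

Definition diag_qform (K : fieldType) N (c : nat -> K) : qform K :=
  existT _ N (diag_mx (\row_(i < N) c i)).

Lemma qpoly_diag (K : fieldType) N (c : nat -> K) :
  Defs.qpoly (diag_qform N c) = \sum_(i < N) c i *: 'X_i ^+ 2 :> {mpoly K[N]}.
Proof.
rewrite /Defs.qpoly /=; apply: eq_bigr => i _.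
rewrite (bigD1 i) //= big1 => [|k ne_ki]; last first.
  by rewrite !mxE eq_sym (negPf ne_ki) scale0r.
by rewrite !mxE eqxx addr0 -expr2.
Qed.

(** * A generic point with coordinates T_0, ..., T_{N-1} and a square root of u *)

Section GenericPoint.
Variables (K Om : fieldType) (N : nat) (c : nat -> K).
Hypothesis char2 : (2 \in [pchar K])%N.
Hypothesis cN0 : c N != 0.
Variables (kap : {rmorphism ratf K N -> Om}) (theta : Om).
Let u : {mpoly K[N]} := \sum_(i < N) (c i / c N) *: 'X_i ^+ 2.
Hypothesis theta2 : theta ^+ 2 = kap (mrat K N u).
Hypothesis theta_sqrt :
  (forall x, theta <> kap x) \/
  exists2 w : {mpoly K[N]}, w ^+ 2 = u & theta = kap (mrat K N w).

(** Dividing the equation by c_N turns the quadric into the condition that the square of the last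
    coordinate is u, signs being irrelevant. The two cases of [theta_sqrt] are a proper quadratic
    extension and a doubled hyperplane. *)
Definition generic_point (i : 'I_N.+1) : Om :=
  if (i < N)%N then kap (ratX K N i) else theta.
Local Notation s := generic_point.
Local Notation kapK := (kap \o ratC K N).
Local Notation phi := (diag_qform N.+1 c).

Lemma generic_pointE p :
  mmap kapK s p = (map_poly (kap \o mrat K N) (muni p)).[theta].
Proof.
rewrite mmap_muni {2}/s ltnn; congr _.[_]; apply: eq_map_poly.
pose h (i : 'I_N) := s (widen_ord (leqnSn N) i).
apply: (mpoly_rmorph_ext (f := mmap kapK h) (g := kap \o mrat K N)) => [b|i].
  by rewrite /= mmapC mratC.
by rewrite /= mmapX mmap1U mratX /h /s /= ltn_ord.
Qed.

Lemma muni_qpoly : muni (Defs.qpoly phi) = (c N)%:MP *: ('X^2 + u%:P).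
Proof.
rewrite qpoly_diag big_ord_recr /= raddfD /= muniZ rmorphXn /= muni_Xmax.
rewrite scalerDr addrC; congr (_ + _).
rewrite raddf_sum /= -mul_polyC -rmorphM /= mul_mpolyC scaler_sumr rmorph_sum.
apply: eq_bigr => i _; rewrite muniZ rmorphXn /= muni_Xwiden scalerA mulrCA divff //.
by rewrite mulr1 -mul_polyC -mul_mpolyC rmorphM /= rmorphXn.
Qed.

Lemma generic_point_quadric : mmap kapK s (Defs.qpoly phi) = 0.
Proof.
rewrite generic_pointE muni_qpoly -mul_polyC rmorphM rmorphD /= map_polyXn !map_polyC /=.
rewrite hornerM hornerD hornerXn !hornerC theta2 addrr_pchar2 ?mulr0 //.
exact: (rmorph_pchar kapK) char2.
Qed.

(** Division by the monic X^2 + u in the last variable leaves R_0 + R_1 X, which vanishes at theta.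
    If theta is not in E, both coefficients are 0 and m = 1 works. If theta = w, the remainder is
    R_1 (X + w), whose square is R_1^2 (X^2 + u), so m = 2 works. *)
Lemma generic_point_generic p :
  mmap kapK s p = 0 -> exists m g, p ^+ m = g * Defs.qpoly phi.
Proof.
pose Q : {poly {mpoly K[N]}} := 'X^2 + u%:P; pose P := muni p; pose G := Pdiv.Ring.rdivp P Q.
pose R := Pdiv.Ring.rmodp P Q.
have monQ : Q \is monic by apply: monicXnaddC.
have PE : P = G * Q + R by apply: Pdiv.RingMonic.rdivp_eq.
have sR : (size R <= 2)%N.
  by rewrite -ltnS -(size_XnaddC u (n := 2)) // Pdiv.Ring.ltn_rmodpN0 // monic_neq0.
have RE : R = (R`_0)%:P + (R`_1)%:P * 'X.
  apply/polyP => -[|[|k]]; rewrite coefD coefC coefMX coefC /= ?addr0 ?add0r //.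
  by rewrite nth_default //; apply: leq_trans sR _.
have QE : Q = (c N)^-1%:MP *: muni (Defs.qpoly phi).
  by rewrite muni_qpoly scalerA -rmorphM /= mulVf // mpolyC1 scale1r.
have conclude m H : P ^+ m = H * Q -> exists m g, p ^+ m = g * Defs.qpoly phi.
  move=> e; exists m, (of_uni K N (H * ((c N)^-1%:MP)%:P)).
  rewrite -[X in _ = _ * X]muniK -rmorphM -[LHS]muniK; congr (of_uni K N _).
  by rewrite rmorphXn -/P e QE -mul_polyC mulrA.
have R01 : kap (mrat K N R`_0) + kap (mrat K N R`_1) * theta = 0 -> 
    exists m g, p ^+ m = g * Defs.qpoly phi.
  case: theta_sqrt => [nsq | [w wu ->]].
    have [R1|R1] := eqVneq (R`_1) 0.
      rewrite R1 !rmorph0 mul0r addr0 -[X in _ = X](rmorph0 kap) => /fmorph_inj.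
      move=> /mrat_eq0 R0; apply: (conclude 1%N G).
      by rewrite expr1 PE RE R0 R1 mul0r !addr0.
    have mR1 : mrat K N R`_1 != 0 by apply: contra_neq R1 => /mrat_eq0.
    move=> e; exfalso; apply: (nsq (- (mrat K N R`_0 / mrat K N R`_1))).
    rewrite rmorphN fmorph_div; apply/eqP; rewrite -addr_eq0 addrC.
    have km : kap (mrat K N R`_1) != 0 by rewrite fmorph_eq0.
    have -> : kap (mrat K N R`_0) / kap (mrat K N R`_1) + theta =
      (kap (mrat K N R`_0) + kap (mrat K N R`_1) * theta) / kap (mrat K N R`_1).
      by field.
    by rewrite e mul0r.
  rewrite -!rmorphM -!rmorphD -[X in _ = X](rmorph0 kap) => /fmorph_inj.
  move=> /mrat_eq0 /eqP.
  rewrite addr_eq0 oppr_pchar2; last exact: (rmorph_pchar (@mpolyC N K)) char2.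
  move=> /eqP R0; apply: (conclude 2%N (G ^+ 2 * Q + 2%:R * G * R + (R`_1)%:P ^+ 2)).
  have e2 : 2%:R = 0 :> {poly {mpoly K[N]}}.
    by apply: pcharf0; apply: (rmorph_pchar (polyC \o @mpolyC N K)) char2.
  have R2 : R ^+ 2 = (R`_1)%:P ^+ 2 * Q.
    rewrite /Q -wu {1}RE R0 rmorphM rmorphXn /=.
    have -> : ((R`_1)%:P * w%:P + (R`_1)%:P * 'X) ^+ 2 =
      (R`_1)%:P ^+ 2 * ('X^2 + w%:P ^+ 2) + 2%:R * ((R`_1)%:P ^+ 2 * w%:P * 'X) by ring.
    by rewrite e2 mul0r addr0.
  by rewrite PE sqrrD R2; ring.
move=> ps; apply: R01; rewrite -[RHS]ps generic_pointE -/P PE rmorphD rmorphM /=.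
rewrite hornerD hornerM rmorphD /= map_polyXn map_polyC hornerD hornerXn hornerC /=.
rewrite theta2 addrr_pchar2 ?mulr0 ?add0r; last first.
  exact: (rmorph_pchar kapK) char2.
rewrite {3}RE rmorphD rmorphM /= !map_polyC map_polyX.
by rewrite hornerD hornerM !hornerC hornerX.
Qed.

End GenericPoint.

(** * Similitudes from Lagrangians *)

Lemma adjoin_sqrt (E : fieldType) (u : E) : (forall x, x ^+ 2 != u) ->
  exists (Om : fieldType) (kap : {rmorphism E -> Om}) (theta : Om),
    [/\ theta ^+ 2 = kap u, forall x, theta <> kap x &
        forall om, exists x y, om = kap x + kap y * theta].
Proof.
move=> nsq; pose h : {poly E} := 'X^2 - u%:P.
have sh : size h = 3%N by rewrite size_XnsubC.
have monh : h \is monic by rewrite monicXnsubC.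
have irrh : irreducible_poly h.
  apply: cubic_irreducible; first by rewrite sh.
  by move=> x; rewrite /root !hornerE /= subr_eq0; exact: nsq.
pose hI : monic_irreducible_poly h := (irrh, monh).
pose Om : fieldType := {poly %/ h with hI}.
pose pi : {rmorphism {poly E} -> {poly %/ h}} := in_qpoly h.
have hE : mk_monic h = h by exact: mk_monicE hI.
have valpi (p : {poly E}) : (size p < 3)%N -> val (pi p) = p.
  by move=> sp; rewrite /= hE Pdiv.Ring.rmodp_small // sh.
exists Om, (pi \o @polyC E), (pi 'X); split.
- have pih : pi h = 0.
    by apply: val_inj; rewrite /= hE Pdiv.RingMonic.rmodpp.
  have -> : pi 'X ^+ 2 = pi (h + u%:P) by rewrite subrK rmorphXn.
  by rewrite rmorphD /= pih add0r.
- move=> x /(congr1 val); rewrite !valpi ?size_polyX //; last first.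
    by apply: leq_ltn_trans (size_polyC_leq1 _) _.
  by move/(congr1 (coefp 1)) => /=; rewrite coefX coefC => /eqP; rewrite oner_eq0.
- move=> om; exists (val om)`_0, (val om)`_1.
  rewrite /= -!rmorphM -rmorphD /=; apply: val_inj.
  have som : (size (val om : {poly E}) < 3)%N.
    by apply: leq_trans (size_mk_monic om) _; rewrite [mk_monic _]hE sh.
  rewrite valpi.
    apply/polyP => -[|[|k]]; rewrite coefD coefC coefMX coefC /= ?addr0 ?add0r //.
    by rewrite nth_default //; move: som; rewrite ltnS => /leq_trans; apply.
  apply: leq_ltn_trans (size_polyD _ _) _; rewrite gtn_max; apply/andP; split.
    by apply: leq_ltn_trans (size_polyC_leq1 _) _.
  by rewrite mul_polyC; apply: leq_ltn_trans (size_scale_leq _ _) _; rewrite size_polyX.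
Qed.

Section Similitude.
Variables (E Om : fieldType) (kap : {rmorphism E -> Om}) (theta : Om) (u : E).
Hypothesis char2 : (2 \in [pchar E])%N.
Hypothesis theta2 : theta ^+ 2 = kap u.
Hypothesis nsq : forall x, theta <> kap x.
Hypothesis gen : forall om, exists x y, om = kap x + kap y * theta.

Let kap_free x y : kap x + kap y * theta = 0 -> x = 0 /\ y = 0.
Proof.
move=> e; have [y0|y0] := eqVneq y 0.
  by move/eqP: e; rewrite y0 rmorph0 mul0r addr0 fmorph_eq0 => /eqP.
case: (nsq (x := - (x / y))); rewrite rmorphN fmorph_div.
apply/eqP; rewrite -addr_eq0.
have ky : kap y != 0 by rewrite fmorph_eq0.
have -> : theta + kap x / kap y = (kap x + kap y * theta) / kap y by field.
by rewrite e mul0r.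
Qed.

(* A Lagrangian over E(theta) meets E^n trivially, so for dimension reasons it
   is the graph of an E-linear map e |-> x, via the vectors x + theta e. *)
Lemma lagrangian_similitude n m (A : 'M[E]_n) (U : 'M[Om]_(m, n)) :
  aniso A -> n = (m + m)%N -> row_free U ->
  (forall z, qf (map_mx kap A) (z *m U) = 0) ->
  forall e, exists x, qf A x = u * qf A e /\ bf A x e = 0.
Proof.
move=> anA nE fU qU.
have [fx fxP] := choice gen; have [fy fyP] := choice fxP.
pose X := map_mx fx U; pose Y := map_mx fy U.
have UE : U = map_mx kap X + theta *: map_mx kap Y.
  by apply/matrixP => i k; rewrite !mxE mulrC -fyP.
(* For z = (x, y) over E, the vector (x + theta y) U has E-part z R and theta-part z S; the factor u
   in [R] is the square of theta. *)
pose S := col_mx Y X; pose R := col_mx X (u *: Y).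
have zU (z : 'rV_(m + m)) : (map_mx kap (lsubmx z) + theta *: map_mx kap (rsubmx z)) *m U
    = map_mx kap (z *m R) + theta *: map_mx kap (z *m S).
  rewrite -{3 4}[z]hsubmxK !mul_row_col !map_mxD !map_mxM UE map_mxZ.
  rewrite mulmxDl !mulmxDr -!scalemxAl -!scalemxAr !scalerA !scalerDr -expr2 theta2.
  by rewrite [_ *: _ + kap u *: _]addrC addrACA.
have zRS z : qf A (z *m R) = u * qf A (z *m S) /\ bf A (z *m R) (z *m S) = 0.
  have := qU (map_mx kap (lsubmx z) + theta *: map_mx kap (rsubmx z)).
  rewrite zU qfD qfZ bfZr !map_qf map_bf theta2 -rmorphM -rmorphD [theta * _]mulrC.
  move=> /kap_free [/eqP]; rewrite addr_eq0 oppr_pchar2 // => /eqP.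
  by split.
have S_inj (z : 'rV_(m + m)) : z *m S = 0 -> z = 0.
  move=> zS; have zR : z *m R = 0.
    by apply: anA; have [-> _] := zRS z; rewrite zS qf0 mulr0.
  have := zU z; rewrite zR zS !map_mx0 scaler0 addr0 -[RHS](mul0mx _ U).
  move=> /(row_free_inj fU) z0.
  have z00 k : lsubmx z 0 k = 0 /\ rsubmx z 0 k = 0.
    by apply: kap_free; have /rowP/(_ k) := z0; rewrite !mxE [theta * _]mulrC.
  have lz : lsubmx z = 0 by apply/rowP => k; rewrite [RHS]mxE; case: (z00 k).
  have rz : rsubmx z = 0 by apply/rowP => k; rewrite [RHS]mxE; case: (z00 k).
  by rewrite -[z]hsubmxK lz rz row_mx0.
have fS : row_free S.
  rewrite -kermx_eq0; apply/eqP/row_matrixP => i; rewrite row0.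
  by apply: S_inj; rewrite -row_mul mulmx_ker row0.
move=> e; have /submxP[z ->] : (e <= S)%MS.
  by apply: submx_full; rewrite /row_full (eqP fS) nE.
by exists (z *m R); exact: zRS.
Qed.

End Similitude.

Lemma map_qform_comp (F K L : fieldType) (f : {rmorphism F -> K})
    (g : {rmorphism K -> L}) (h : {rmorphism F -> L}) phi :
  (forall x, g (f x) = h x) -> map_qform g (map_qform f phi) = map_qform h phi.
Proof.
move=> gf; rewrite /map_qform /=; congr existT.
by apply/matrixP => i k; rewrite !mxE.
Qed.

Lemma map_zeroq (F K : fieldType) (f : {rmorphism F -> K}) m :
  map_qform f (Defs.zeroq F m) = Defs.zeroq K m.
Proof. by rewrite /map_qform /= map_mx0. Qed.

Lemma aniso_witt0 (F : fieldType) (phi : qform F) : aniso (tagged phi) ->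
  witt_equiv phi (Defs.zeroq F 0) -> qdim phi = 0%N.
Proof. by move=> an /witt_zero_lagrangian [m -> /(aniso_isot an) ->]. Qed.

(** * Anisotropic forms becoming hyperbolic over the function field of a diagonal quadric *)

Section FunctionFieldOfDiagonal.
Variables (K L : fieldType) (j : {rmorphism K -> L}) (N : nat) (c : nat -> K).
Hypothesis char2 : (2 \in [pchar K])%N.
Hypothesis cN0 : c N != 0.
Let u : {mpoly K[N]} := \sum_(i < N) (c i / c N) *: 'X_i ^+ 2.

Let mrat_u : mrat K N u = \sum_(i < N) ratC K N (c i / c N) * ratX K N i ^+ 2.
Proof.
rewrite rmorph_sum; apply: eq_bigr => i _.
by rewrite -mul_mpolyC [LHS]rmorphM mratC [X in _ * X]rmorphXn mratX.
Qed.

(** A square root of u would make u a value over E of the anisotropic form of dimension one with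
    entry 1. The descent of diagonal values, applied to this form, then makes every c_i / c_N a
    square in K. *)
Lemma diagonal_nonsquare i0 : (i0 < N)%N -> (forall b, c i0 <> c N * b ^+ 2) ->
  forall x, x ^+ 2 != mrat K N u.
Proof.
move=> lt_i0 nsq x; apply/eqP => x2.
have an1 : aniso (1%:M : 'M[K]_1).
  move=> y /eqP; rewrite /qf mulmx1 mxE big_ord1 mxE mulf_eq0 orbb => /eqP y0.
  by apply/rowP => i; rewrite ord1 y0 mxE.
have qx : qf (map_mx (ratC K N) 1%:M) (x%:M : 'rV_1) =
    \sum_(i < N) ratC K N (c i / c N) * ratX K N i ^+ 2.
  by rewrite -mrat_u -x2 map_mx1 /qf mulmx1 mxE big_ord1 !mxE.
have [|w wP] := represented_diagonal char2 an1 (C := 0 : 'M_(1, 0))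
    (c := fun i => c i / c N) qx.
  by rewrite map_mx0 mulmx0.
have [q0 _ _] := wP _ lt_i0; apply: (nsq (w i0 0 0)).
have := q0; rewrite /qf mulmx1 mxE big_ord1 mxE -expr2 => ->.
by rewrite mulrC divfK.
Qed.

(** Such a linear form vanishes at the generic point, whose coordinates are linearly independent
    over K: theta is not in E and the T_i are algebraically independent. It later shows that an
    isotropic vector over L is nonzero. *)
Lemma linear_form_radical i0 (l : nat -> K) m g :
  (i0 < N)%N -> (forall b, c i0 <> c N * b ^+ 2) ->
  (\sum_(i < N.+1) l i *: 'X_i) ^+ m = g * Defs.qpoly (diag_qform N.+1 c) ->
  forall i, (i <= N)%N -> l i = 0.
Proof.
move=> lt_i0 nsq e.
have [Om [kap [th [th2 th_nsq _]]]] := adjoin_sqrt (diagonal_nonsquare lt_i0 nsq).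
pose s := @generic_point K Om N kap th; pose kapK := kap \o ratC K N.
pose l' : {mpoly K[N]} := \sum_(i < N) l i *: 'X_i.
have : kap (mrat K N l') + kap (ratC K N (l N)) * th = 0.
  have : mmap kapK s (\sum_(i < N.+1) l i *: 'X_i) = 0.
    have /eqP : mmap kapK s (\sum_(i < N.+1) l i *: 'X_i) ^+ m = 0.
      by rewrite -rmorphXn /= e rmorphM /= generic_point_quadric // mulr0.
    by rewrite expf_eq0 => /andP[_ /eqP].
  rewrite big_ord_recr rmorphD rmorph_sum /= mmapZ mmapX mmap1U {2}/s.
  rewrite /generic_point ltnn => e1; rewrite -[RHS]e1; congr (_ + _).
  have -> : mrat K N l' = \sum_(i < N) mrat K N (l i *: 'X_i) by exact: rmorph_sum.
  rewrite rmorph_sum; apply: eq_bigr => i _.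
  rewrite mmapZ mmapX mmap1U /s /generic_point /= ltn_ord.
  by rewrite -mul_mpolyC !rmorphM /= mratC mratX.
move=> e0; have lN : l N = 0.
  apply/eqP; apply: contraT => lN0; exfalso.
  apply: (th_nsq (- (mrat K N l' / ratC K N (l N)))).
  have kN : kap (ratC K N (l N)) != 0 by rewrite !fmorph_eq0.
  rewrite rmorphN fmorph_div; apply/eqP; rewrite -addr_eq0.
  have -> : th + kap (mrat K N l') / kap (ratC K N (l N)) =
    (kap (mrat K N l') + kap (ratC K N (l N)) * th) / kap (ratC K N (l N)) by field.
  by rewrite e0 mul0r.
move: e0; rewrite lN !rmorph0 mul0r addr0 -[X in _ = X](rmorph0 kap).
move=> /fmorph_inj /mrat_eq0 l0 i; rewrite leq_eqVlt => /orP[/eqP -> //|lt_iN].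
have := congr1 (mcoeff U_(Ordinal lt_iN)) l0.
rewrite mcoeff0 linear_sum (bigD1 (Ordinal lt_iN)) //= big1 => [|k ne_k].
  by rewrite mcoeffZ mcoeffXU eqxx mulr1 addr0.
by rewrite mcoeffZ mcoeffXU (negPf ne_k) mulr0.
Qed.

Hypothesis ff : quadric_function_field j (diag_qform N.+1 c).
Variable psi : qform K.
Hypothesis an : aniso (tagged psi).
Hypothesis hyp_psi : witt_equiv (map_qform j psi) (Defs.zeroq L 0).

Let hyp_generic (Om : fieldType) (kap : {rmorphism ratf K N -> Om}) theta :
  theta ^+ 2 = kap (mrat K N u) ->
  (forall x, theta <> kap x) \/ (exists2 w, w ^+ 2 = u & theta = kap (mrat K N w)) ->
  witt_equiv (map_qform kap (map_qform (ratC K N) psi)) (Defs.zeroq Om 0).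
Proof.
move=> th2 th_sqrt.
have [D Dj] := function_field_embed ff (generic_point_quadric char2 cN0 th2)
                 (generic_point_generic char2 cN0 th2 th_sqrt).
have := witt_equiv_map D hyp_psi; rewrite map_zeroq (map_qform_comp _ Dj).
by rewrite (map_qform_comp (h := kap \o ratC K N)).
Qed.

Lemma function_field_split :
  (forall i, (i < N)%N -> exists b, c i = c N * b ^+ 2) -> qdim psi = 0%N.
Proof.
move=> sq; have [b bP] : exists b : 'I_N -> K, forall i : 'I_N, c i = c N * b i ^+ 2.
  have sqN (i : 'I_N) : exists b, c i = c N * b ^+ 2 by exact: sq.
  by have [b bP] := choice sqN; exists b.
pose w : {mpoly K[N]} := \sum_i b i *: 'X_i.
have char2X : (2 \in [pchar {mpoly K[N]}])%N by exact: (rmorph_pchar (@mpolyC N K)) char2.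
have wu : w ^+ 2 = u.
  rewrite -(pFrobenius_autE char2X) rmorph_sum; apply: eq_bigr => i _.
  by rewrite /= pFrobenius_autE exprZn (bP i) mulrC mulKf.
have := hyp_generic (kap := idfun) (theta := mrat K N w).
rewrite (map_qform_comp (h := ratC K N)) // -rmorphXn wu => h.
apply: (aniso_witt0 (phi := map_qform (ratC K N) psi)); first exact: aniso_ratf.
by apply: h => //; right; exists w.
Qed.

Lemma function_field_subform i0 : (i0 < N)%N -> (forall b, c i0 <> c N * b ^+ 2) ->
  forall e, exists w : nat -> 'rV[K]_(qdim psi), forall i, (i <= N)%N ->
    qf (tagged psi) (w i) = qf (tagged psi) e / c N * c i /\
    forall k, (k < i)%N -> bf (tagged psi) (w i) (w k) = 0.
Proof.
move=> lt_i0 nsq e.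
have nsqE := diagonal_nonsquare lt_i0 nsq.
have [Om [kap [theta [th2 th_nsq gen]]]] := adjoin_sqrt nsqE.
have [m nE [U [fU qU]]] := witt_zero_lagrangian (hyp_generic th2 (or_introl th_nsq)).
have charE := pchar_ratf char2 N.
have anE : aniso (map_mx (ratC K N) (tagged psi)) by exact: aniso_ratf.
have [x [qx bx]] := lagrangian_similitude charE th2 th_nsq gen anE nE fU qU
   (map_mx (ratC K N) e).
(* Since [x] has value u psi(e), these are the coefficients of the T_i^2 in that value. *)
pose c' i := qf (tagged psi) e / c N * c i.
have [||w wP] := represented_diagonal char2 an (c := c') (v := x) 
   (C := (tagged psi + (tagged psi)^T) *m e^T).
- rewrite qx map_qf mrat_u mulr_suml; apply: eq_bigr => i _.
  by rewrite /c' mulrAC -rmorphM; congr (ratC K N _ * _); field.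
- apply/matrixP => i k; rewrite !ord1 [RHS]mxE -[RHS]bx /bf.
  by rewrite map_mxM map_mxD !map_trmx mulmxA.
(* The vector e itself serves the index N, where the required value is psi(e); the other vectors
   were kept orthogonal to it through [C]. *)
exists (fun i => if i == N then e else w i) => i; rewrite leq_eqVlt.
case/orP=> [/eqP ->|lt_iN].
  rewrite eqxx divfK //; split=> // k lt_kN; rewrite ltn_eqF //.
  have [_ + _] := wP _ lt_kN => /matrixP/(_ 0 0).
  by rewrite mulmxA [RHS]mxE bfC.
rewrite ltn_eqF //; have [qw _ bw] := wP _ lt_iN; split=> // k lt_ki.
by rewrite ltn_eqF ?bw // (ltn_trans lt_ki).
Qed.

End FunctionFieldOfDiagonal.

(** * The action of bilinear forms on the Witt group *)

Lemma qf_scale (F : fieldType) a (phi : qform F) (x : 'rV_(qdim phi)) :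
  qf (tagged (scaleq a phi)) x = a * qf (tagged phi) x.
Proof. exact: qval_scale. Qed.

Section WittAction.
Variable F : fieldType.
Implicit Types (a b c d : F) (v w : Wq F).

(* Total extension of Wq_scale, with wsc 0 w = 0. *)
Definition wsc a w : Wq F :=
  if @idP (a != 0) is ReflectT a0 then Wq_scale a0 w else 0.

Lemma wscE a (a0 : a != 0) w : wsc a w = Wq_scale a0 w.
Proof.
by rewrite /wsc; case: {-}_ / idP => [h|]; rewrite ?a0 // (bool_irrelevance h a0).
Qed.

Lemma wsc_class a (a0 : a != 0) phi : wsc a (wclass phi) = wclass (nsscale a0 phi).
Proof. by rewrite wscE Wq_scaleE. Qed.

Lemma wsc0 w : wsc 0 w = 0.
Proof. by rewrite /wsc; case: {-}_ / idP => // h; have := h; rewrite eqxx. Qed.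

Lemma wclassD phi psi : wclass phi + wclass psi = wclass (nsorth phi psi) :> Wq F.
Proof. exact: Wq_addE. Qed.

Lemma wclass_isom (phi psi : nsform F) :
  isometric (val phi) (val psi) -> wclass phi = wclass psi.
Proof. by move=> h; apply/wclassP/witt_equiv_isom. Qed.

Lemma wscD a v w : wsc a (v + w) = wsc a v + wsc a w.
Proof.
have [->|a0] := eqVneq a 0; first by rewrite !wsc0 addr0.
rewrite -(wreprK v) -(wreprK w) wclassD !(wsc_class a0) wclassD.
apply: wclass_isom; rewrite /= scaleq_orth; exact: isom_refl.
Qed.

Lemma wscr0 a : wsc a 0 = 0.
Proof. by apply: (addIr (wsc a 0)); rewrite -wscD !add0r. Qed.

Lemma wscM a b w : wsc a (wsc b w) = wsc (a * b) w.
Proof.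
have [->|a0] := eqVneq a 0; first by rewrite mul0r !wsc0.
have [->|b0] := eqVneq b 0; first by rewrite mulr0 !wsc0 wscr0.
rewrite -(wreprK w) (wsc_class b0) (wsc_class a0) (wsc_class (mulf_neq0 a0 b0)).
apply: wclass_isom; rewrite /= /scaleq /= scalerA; exact: isom_refl.
Qed.

Lemma wsc_sqr a w : a != 0 -> wsc (a ^+ 2) w = w.
Proof.
move=> a0; rewrite -(wreprK w) (wsc_class (expf_neq0 2 a0)).
set phi := wrepr w; apply: wclass_isom => /=.
apply: (@isometric_mx _ (scaleq (a ^+ 2) (val phi)) (val phi) a%:M) => //.
  by rewrite row_free_unit unitmxE det_scalar unitrX ?unitfE.
by move=> x; rewrite mul_mx_scalar qfZ qf_scale.
Qed.

Lemma wsc1 w : wsc 1 w = w.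
Proof. by rewrite -(expr1n _ 2) wsc_sqr ?oner_neq0. Qed.

Hypothesis char2 : (2 \in [pchar F])%N.

Lemma Wq_addrr w : w + w = 0.
Proof.
rewrite -[X in X + _]opprK -[X in - X]/(Wq_opp w) /Wq_opp -wscE.
by rewrite oppr_pchar2 // wsc1 addNr.
Qed.

(* <c, d> and <c + d, cd(c + d)> are isometric. *)
Lemma wsc_add c d w : c != 0 -> d != 0 -> c + d != 0 ->
  wsc c w + wsc d w = wsc (c + d) w + wsc (c * d * (c + d)) w.
Proof.
move=> c0 d0 cd0; have e0 : c * d * (c + d) != 0 by rewrite !mulf_neq0.
rewrite -(wreprK w) (wsc_class c0) (wsc_class d0) (wsc_class cd0) (wsc_class e0).
rewrite !wclassD; set phi := wrepr w; apply/esym/wclass_isom => /=.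
set A := val phi; pose n := qdim A.
apply: (@isometric_mx _ (orth (scaleq (c + d) A) (scaleq (c * d * (c + d)) A))
  (orth (scaleq c A) (scaleq d A)) (block_mx 1%:M 1%:M d%:M c%:M : 'M_(n + n))) => //.
  apply/row_freeP; exists ((c + d)^-1 *: block_mx c%:M 1%:M d%:M 1%:M).
  rewrite -scalemxAr mulmx_block !mul1mx !mulmx1 !mul_scalar_mx !scale_scalar_mx.
  rewrite -!raddfD /= [c * d]mulrC !addrr_pchar2 // [d + c]addrC raddf0.
  by rewrite -scalar_mx_block scale_scalar_mx mulVf.
move=> x; rewrite -[x]hsubmxK; set y := lsubmx _; set z := rsubmx _.
rewrite mul_row_block !mulmx1 !mul_mx_scalar.
rewrite (@qf_orth _ (scaleq c A) (scaleq d A)) (@qf_orth _ (scaleq _ A) (scaleq _ A)).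
rewrite !qf_scale !qfD !qfZ !bfZr.
have e2 : 2%:R = 0 :> F by apply: pcharf0.
set p := qf _ y; set q := qf _ z; set b := bf _ _ _.
have -> : c * (p + d ^+ 2 * q + d * b) + d * (p + c ^+ 2 * q + c * b) =
  (c + d) * p + c * d * (c + d) * q + 2%:R * (c * d * b) by ring.
by rewrite e2 mul0r addr0.
Qed.

Lemma Wq_actE (s : seq (nzelt F)) w : Wq_act s w = \sum_(a <- s) wsc (val a) w.
Proof. by apply: eq_bigr => a _; rewrite (wscE (valP a)). Qed.

Lemma Wq_actD (s : seq (nzelt F)) v w : Wq_act s (v + w) = Wq_act s v + Wq_act s w.
Proof. by rewrite !Wq_actE -big_split; apply: eq_bigr => a _; rewrite wscD. Qed.

End WittAction.

(** * Roundness of Pfister forms on the Witt group *)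

Section PfisterAction.
Variable F : fieldType.
Hypothesis char2 : (2 \in [pchar F])%N.
Implicit Types (s : seq (nzelt F)) (t : seq F) (x : nat -> F).

Definition dsum t x : F := \sum_(i < size t) t`_i * x i ^+ 2.

Lemma dsum_cat t1 t2 x :
  dsum (t1 ++ t2) x = dsum t1 x + dsum t2 (fun i => x (size t1 + i)%N).
Proof.
rewrite /dsum size_cat big_split_ord; congr (_ + _); apply: eq_bigr => i _ /=.
  by rewrite nth_cat ltn_ord.
by rewrite nth_cat ltnNge leq_addr /= addKn.
Qed.

Lemma dsum_mul a t x : dsum [seq a * b | b <- t] x = a * dsum t x.
Proof.
rewrite /dsum size_map mulr_sumr; apply: eq_bigr => i _.
by rewrite (nth_map 0) ?ltn_ord // mulrA.
Qed.

Definition pfister_entries s : seq F := [seq val b | b <- pfister s].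

Lemma pfister_entries_cons a s : pfister_entries (a :: s) =
  pfister_entries s ++ [seq val a * b | b <- pfister_entries s].
Proof.
rewrite /pfister_entries /= /btens /= cats0 map_cat -!map_comp.
by congr (_ ++ _); apply: eq_map => b /=; rewrite mul1r.
Qed.

Lemma pfister_actE s w : Wq_act (pfister s) w = \sum_(b <- pfister_entries s) wsc b w.
Proof. by rewrite Wq_actE big_map. Qed.

Lemma pfister_act_cons a s w : Wq_act (pfister (a :: s)) w =
  Wq_act (pfister s) w + wsc (val a) (Wq_act (pfister s) w).
Proof.
rewrite !pfister_actE pfister_entries_cons big_cat big_map; congr (_ + _).
rewrite (big_morph _ (wscD _) (wscr0 _)).
by rewrite !big_map; apply: eq_bigr => b _; rewrite wscM.
Qed.

(** Values of a Pfister form are similarity factors. For a value p + b q with p, q and the sum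
    nonzero, p and q fix z by induction, so z + b z = p z + b q z = (p + b q)(z + p b q z) by
    [wsc_add], and p b q z = b z. *)
Lemma pfister_round s x w : dsum (pfister_entries s) x != 0 ->
  wsc (dsum (pfister_entries s) x) (Wq_act (pfister s) w) = Wq_act (pfister s) w.
Proof.
elim: s x => [|a s IH] x.
  have -> : dsum (pfister_entries [::]) x = x 0%N ^+ 2 by rewrite /dsum big_ord1 mul1r.
  move=> x0; rewrite wsc_sqr //; apply: contra_neq x0 => ->.
  by rewrite expr0n.
rewrite pfister_entries_cons dsum_cat dsum_mul pfister_act_cons.
set p := dsum _ x; set q := dsum _ _; set z := Wq_act (pfister s) w.
have a0 := valP a; set b := val a in a0 *.
have azz : wsc b (wsc b z) = z by rewrite wscM -expr2 wsc_sqr.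
have [q0|q0] := eqVneq q 0.
  rewrite q0 mulr0 addr0 => p0.
  by rewrite wscD wscM mulrC -wscM IH.
have qz : wsc q z = z by exact: IH.
have [p0|p0] := eqVneq p 0.
  rewrite p0 add0r => _; rewrite -wscM wscD [wsc q (wsc b z)]wscM mulrC -wscM qz.
  by rewrite wscD azz addrC.
have pz : wsc p z = z by exact: IH.
have bq0 : b * q != 0 by rewrite mulf_neq0.
move=> pq0.
have e : z + wsc b z = wsc p z + wsc (b * q) z by rewrite pz -wscM qz.
rewrite [RHS]e (wsc_add char2 z p0 bq0 pq0) wscD; congr (_ + _).
by rewrite wscM -[in LHS]pz -[in LHS]qz !wscM; congr (wsc _ z); ring.
Qed.

(** An isotropic vector gives p = b q for values p, q of the shorter form. If q = 0 that form is
    already isotropic; otherwise roundness gives b z = z, and z + z = 0. *)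
Lemma pfister_isotropic s x w i : (i < size (pfister_entries s))%N -> x i != 0 ->
  dsum (pfister_entries s) x = 0 -> Wq_act (pfister s) w = 0.
Proof.
elim: s x i => [|a s IH] x i.
  rewrite /dsum /= ltnS leqn0 big_ord1 mul1r => /eqP -> x0 /eqP.
  by rewrite expf_eq0 (negPf x0).
rewrite pfister_entries_cons dsum_cat dsum_mul pfister_act_cons size_cat.
rewrite (size_map (fun b => val a * b)); set n := size _.
set p := dsum _ x; set q := dsum _ _; set z := Wq_act (pfister s) w.
move=> lt_i xi0 /eqP; rewrite addr_eq0 oppr_pchar2 // => /eqP pq.
have a0 := valP a; set b := val a in a0 pq *.
have [q0|q0] := eqVneq q 0.
  have z0 : z = 0.
    have [lt_in|le_ni] := ltnP i n.
      by apply: (IH x i lt_in xi0); rewrite -[LHS]/p pq q0 mulr0.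
    by apply: (IH (fun k => x (n + k)%N) (i - n)%N); rewrite ?subnKC //; lia.
  by rewrite z0 wscr0 addr0.
have qz : wsc q z = z by exact: pfister_round.
have p_neq0 : p != 0 by rewrite pq mulf_neq0.
have pz : wsc p z = z by exact: pfister_round.
have : wsc b z = z by rewrite -{1}qz wscM -pq pz.
by move=> ->; rewrite Wq_addrr.
Qed.

End PfisterAction.

(** * Anisotropic parts over exponent one extensions *)

Lemma row_freeI (F : fieldType) m n (G : 'M[F]_(m, n)) :
  (forall z : 'rV_m, z *m G = 0 -> z = 0) -> row_free G.
Proof.
move=> G_inj; rewrite -kermx_eq0; apply/eqP/row_matrixP => i; rewrite row0.
by apply: G_inj; rewrite -row_mul mulmx_ker row0.
Qed.

Lemma nonsingular_isom (F : fieldType) (phi psi : qform F) :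
  isometric phi psi -> nonsingular phi -> nonsingular psi.
Proof.
move=> h /nonsingular_bf ns; have [G [fG qG]] := isometric_mxP (isom_sym h).
apply/nonsingular_bf => x x0; apply: (row_free_inj fG); rewrite mul0mx.
apply: ns => y; have [H [_ qH]] := isometric_mxP h.
have fullG : row_full G by rewrite /row_full (eqP fG) (isometric_dim h).
have /submxP[z ->] := submx_full y fullG.
by rewrite bfE -mulmxDl !qG -bfE.
Qed.

Lemma nonsingular_orthl (F : fieldType) (phi psi : qform F) :
  nonsingular (orth phi psi) -> nonsingular phi.
Proof.
move=> /nonsingular_bf ns; apply/nonsingular_bf => x x0.
have : row_mx x (0 : 'rV_(qdim psi)) = 0; last first.
  by move/eqP; rewrite row_mx_eq0 => /andP[/eqP].
apply: ns => y; rewrite -[y](@hsubmxK _ _ (qdim phi) (qdim psi)) bf_orth bf0l addr0.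
exact: x0.
Qed.

Lemma nonsingular_map_inv (F K : fieldType) (f : {rmorphism F -> K}) phi :
  nonsingular (map_qform f phi) -> nonsingular phi.
Proof.
move=> /nonsingularP u; apply/nonsingularP; move: u => /=.
by rewrite map_trmx -map_mxD map_unitmx.
Qed.

Lemma qf_diag (R : comNzRingType) n (d x : 'rV[R]_n) :
  qf (diag_mx d) x = \sum_i d 0 i * x 0 i ^+ 2.
Proof.
rewrite qfE; apply: eq_bigr => i _; rewrite (bigD1 i) //= big1 => [|k ne_ki].
  by rewrite !mxE eqxx addr0 /=; ring.
by rewrite !mxE eq_sym (negPf ne_ki) mulr0n mulr0 mul0r.
Qed.

Section RationalReduction.
Variables (F K : fieldType) (iota : {rmorphism F -> K}).
Hypothesis char2 : (2 \in [pchar F])%N.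
Hypothesis insep : forall x : K, exists y : F, x ^+ 2 = iota y.

Let char2K : (2 \in [pchar K])%N.
Proof. exact: (rmorph_pchar iota) char2. Qed.

(* If [v] is isotropic over K, let f be a basis vector with bf v f = 1, and let
   H be a complement of f in the orthogonal of f. Then h |-> h + bf(h, v) f maps
   H onto a complement of v in its orthogonal, and the induced form
   qf h + bf(h, v)^2 qf f on H is again defined over F as K^2 is in F. *)
Lemma rational_reduction (phi : qform F) : nonsingular phi ->
  ~ aniso (map_mx iota (tagged phi)) ->
  exists phi' : qform F, [/\ nonsingular phi', (qdim phi' < qdim phi)%N &
    witt_equiv (map_qform iota phi) (map_qform iota phi')].
Proof.
move=> ns /existsNP [v0 /not_implyP [qv0 /eqP v0_neq0]].
set A := tagged phi in qv0 *; set n := qdim phi in A v0 qv0 v0_neq0 *.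
pose AK := map_mx iota A; pose M := A + A^T.
have [j mj] : exists i, (v0 *m (AK + AK^T)) 0 i != 0.
  apply/existsP; apply: contraNT v0_neq0; rewrite negb_exists => /forallP m0.
  have /nonsingularP u : nonsingular (map_qform iota phi) by exact: nonsingular_map.
  apply/eqP; rewrite -[LHS](mulmxK u); apply/eqP.
  rewrite (_ : v0 *m _ = 0) ?mul0mx //; apply/rowP => i; rewrite [RHS]mxE.
  by apply/eqP; have := m0 i; rewrite negbK.
pose v := ((v0 *m (AK + AK^T)) 0 j)^-1 *: v0.
pose mu := v *m (AK + AK^T).
have qv : qf AK v = 0 by rewrite qfZ qv0 mulr0.
have muj : mu 0 j = 1 by rewrite /mu -scalemxAl mxE mulVf.
clearbody v.
have bv x : bf AK v x = \sum_i mu 0 i * x 0 i.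
  by rewrite /bf -/mu mxE; apply: eq_bigr => i _; rewrite !mxE.
pose f : 'rV[F]_n := delta_mx 0 j; pose fK := map_mx iota f.
have fKE i : fK 0 i = (i == j)%:R by rewrite /fK /f !mxE rmorph_nat.
have bvf : bf AK v fK = 1.
  rewrite bv (bigD1 j) //= big1 => [|i ne_ij].
    by rewrite fKE eqxx muj mulr1 addr0.
  by rewrite fKE (negPf ne_ij) mulr0.
have [m mP] := choice (fun i => insep (mu 0 i)).
pose q := qf A f; pose qK := iota q.
have qfK : qf AK fK = qK by rewrite map_qf.
(* The left kernel of [C] consists of the vectors orthogonal to f with vanishing j-th coordinate;
   the latter condition selects a complement of the line of f. Two conditions leave dimension at
   least n - 2. *)
pose C := row_mx f^T (M *m f^T).
have [r [P [PC fP le_nr]]] : exists r (P : 'M[F]_(r, n)),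
    [/\ P *m C = 0, row_free P & (n <= r + (1 + 1))%N].
  exists (\rank (kermx C)), (row_base (kermx C)); split; last first.
  - by rewrite mxrank_ker; have := rank_leq_col C; lia.
  - exact: row_base_free.
  - by apply/eqP; rewrite -sub_kermx eq_row_base.
pose PK := map_mx iota P.
have [Pf PMf] : P *m f^T = 0 /\ P *m (M *m f^T) = 0.
  by move/eqP: PC; rewrite mul_mx_row row_mx_eq0 => /andP[/eqP -> /eqP ->].
have xj h : (h *m PK) 0 j = 0.
  have -> : (h *m PK) 0 j = (h *m (PK *m fK^T)) 0 0.
    by rewrite mulmxA /fK map_delta_mx trmx_delta -colE [RHS]mxE.
  by rewrite /fK map_trmx -map_mxM Pf map_mx0 mulmx0 mxE.
have bxf h : bf AK (h *m PK) fK = 0.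
  rewrite /bf -!mulmxA (_ : PK *m _ = 0) ?mulmx0 ?mxE //.
  by rewrite /fK !map_trmx -map_mxD -!map_mxM PMf map_mx0.
(* As squaring is additive, bf(v, x)^2 is the sum of the mu_i^2 x_i^2, and mu_i^2 is the image of
   [m i]: this is the correction term written over F. *)
pose D := diag_mx (\row_i (q * m i)).
pose phi' : qform F := existT _ r (P *m (A + D) *m P^T).
have q' h : qf (tagged (map_qform iota phi')) h =
    qf AK (h *m PK) + qK * bf AK v (h *m PK) ^+ 2.
  rewrite /= !map_mxM -map_trmx -qf_mul map_mxD {1}/qf mulmxDr mulmxDl mxE.
  congr (_ + _); rewrite -/(qf _ _) map_diag_mx qf_diag bv.
  rewrite -(pFrobenius_autE char2K) rmorph_sum mulr_sumr; apply: eq_bigr => i _ /=.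
  rewrite pFrobenius_autE exprMn mP [RHS]mulrA; congr (_ * _).
  by rewrite !mxE rmorphM.
(* The image of H is completed by the hyperbolic pair v and f + qf(f) v; the second vector is
   isotropic because its value is twice qf(f). *)
pose G := col_mx (PK + (PK *m mu^T) *m fK) (col_mx v (fK + qK *: v)).
have GE h (a b : K) : row_mx h (row_mx a%:M b%:M) *m G =
    h *m PK + bf AK v (h *m PK) *: fK + (a *: v + b *: (fK + qK *: v)).
  rewrite !mul_row_col !mul_scalar_mx mulmxDr; congr (_ + _ + _).
  rewrite !mulmxA [h *m PK *m mu^T]mx11_scalar mul_scalar_mx; congr (_ *: _).
  by rewrite -trmx11E trmx_mul trmxK.
have row_mxE (x : 'rV_(r + (1 + 1))) :
    exists (h : 'rV[K]_r) (a b : K), x = row_mx h (row_mx a%:M b%:M).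
  exists (lsubmx x), (lsubmx (rsubmx x) 0 0), (rsubmx (rsubmx x) 0 0).
  by rewrite -!mx11_scalar !hsubmxK.
have bff : bf AK fK fK = 0 by rewrite bfxx addrr_pchar2.
have bvv : bf AK v v = 0 by rewrite bfxx addrr_pchar2.
have fG : row_free G.
  apply: row_freeI => x; have [h [a [b ->]]] := row_mxE x; rewrite GE => e0.
  have ab : a + b * qK = 0.
    have := congr1 (fun y => bf AK y fK) e0.
    by rewrite bf0l !(bfDl, bfZl) bxf bff bvf !mulr0 !add0r !mulr1.
  have bb : bf AK v (h *m PK) + b = 0.
    have addE (y z : 'rV[K]_n) : (y + z) 0 j = y 0 j + z 0 j by rewrite mxE.
    have scaleE k (y : 'rV[K]_n) : (k *: y) 0 j = k * y 0 j by rewrite mxE.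
    have := congr1 (fun y : 'rV_n => y 0 j) e0.
    rewrite !(addE, scaleE) xj fKE eqxx [RHS]mxE => e1.
    transitivity (0 + bf AK v (h *m PK) * 1 + (a * v 0 j + b * (1 + qK * v 0 j))
                    - (a + b * qK) * v 0 j); first by ring.
    by rewrite [X in X - _]e1 ab mul0r subrr.
  have hP0 : h *m PK = 0.
    rewrite -[RHS]e0 -[LHS]addr0 -addrA; congr (_ + _).
    transitivity ((bf AK v (h *m PK) + b) *: fK + (a + b * qK) *: v).
      by rewrite ab bb !scale0r addr0.
    by rewrite !scalerDl scalerDr scalerA addrACA -!addrA.
  have h0 : h = 0.
    by apply: (row_free_inj (A := PK)); rewrite ?mul0mx // row_free_map.
  move: bb ab; rewrite hP0 bf0r add0r => ->; rewrite mul0r addr0 => ->.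
  by rewrite h0 raddf0 !row_mx0.
have qG x : qf AK (x *m G) = qf (tagged (orth (map_qform iota phi') (hyp K 1))) x.
  have [h [a [b ->]]] := row_mxE x.
  rewrite GE (@qf_orth _ (map_qform iota phi') (hyp K 1)) qf_hyp q'.
  rewrite !(qfD, qfZ, bfDl, bfDr, bfZl, bfZr) qv qfK bff bvv bvf bxf.
  rewrite [bf AK (h *m PK) v]bfC [bf AK fK v]bfC bvf.
  have -> : (a%:M *m (b%:M)^T : 'M_1) 0 0 = a * b.
    by rewrite tr_scalar_mx mul_scalar_mx !mxE eqxx.
  have e2 : 2%:R = 0 :> K by apply: pcharf0.
  set t := bf _ _ _; set X := qf _ _.
  apply/eqP; rewrite -subr_eq0; apply/eqP.
  transitivity (2%:R * (b ^+ 2 * qK + a * t + b * qK * t)); last by rewrite e2 mul0r.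
  by ring.
have iso : isometric (orth (map_qform iota phi') (hyp K 1)) (map_qform iota phi).
  exact: (@isometric_mx _ (orth (map_qform iota phi') (hyp K 1)) (map_qform iota phi)
            G fG le_nr qG).
exists phi'; split.
- apply: (nonsingular_map_inv (f := iota)); apply: nonsingular_orthl.
  by apply: nonsingular_isom (isom_sym iso) _; apply: nonsingular_map.
- have e : (r + (1 + 1) = n)%N := isometric_dim iso.
  by have : (r < r + (1 + 1))%N; [lia | rewrite e].
- exists 0%N, 1%N; apply: isom_trans (isom_sym iso).
  by apply: isom_trans (isom_orth (isom_refl _) (isom_hyp0 K)) _; exact: isom_orth0.
Qed.

Lemma rational_anisotropic_part (phi : nsform F) : exists phi' : nsform F,
  [/\ aniso (map_mx iota (tagged (val phi'))), (qdim (val phi') <= qdim (val phi))%N &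
    witt_equiv (map_qform iota (val phi)) (map_qform iota (val phi'))].
Proof.
have [m] := ubnP (qdim (val phi)); elim: m phi => // m IH phi lt_m.
have [an|nan] := pselect (aniso (map_mx iota (tagged (val phi)))).
  by exists phi; split=> //; exact: witt_equiv_refl.
have [phi1 [ns1 lt1 w1]] := rational_reduction (nsformP phi) nan.
have [phi2 [an2 le2 w2]] := IH (mk_nsform ns1) (leq_trans lt1 lt_m).
exists phi2; split=> //; first exact: leq_trans le2 (ltnW lt1).
exact: witt_equiv_trans w1 w2.
Qed.

End RationalReduction.

(** * Dimension drop *)

Section BinaryTensor.
Variable K : fieldType.
Variables d e : K.

(** The form [d, e], that is d x^2 + x y + e y^2; below, [binary_tensor] is its product with a
    diagonal bilinear form. *)
Definition binary : qform K :=
  existT (fun n => 'M[K]_n) (1 + 1)%N (block_mx d%:M 1%:M 0 e%:M).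

Lemma qf_binary (x y : 'rV[K]_1) : qf (tagged binary) (row_mx x y) =
  d * x 0 0 ^+ 2 + x 0 0 * y 0 0 + e * y 0 0 ^+ 2.
Proof.
rewrite /qf /= mul_row_block tr_row_mx mul_row_col [x]mx11_scalar [y]mx11_scalar.
rewrite !mulmx0 addr0 !mulmx1 !tr_scalar_mx -!scalar_mxM -!raddfD /= -!scalar_mxM.
by rewrite -raddfD /= !mxE eqxx !mulr1n; ring.
Qed.

Definition binary_tensor (t : seq K) : qform K :=
  foldr (fun a phi => orth (scaleq a binary) phi) (Defs.zeroq K 0) t.

Lemma qdim_binary_tensor t : qdim (binary_tensor t) = (size t + size t)%N.
Proof. by elim: t => //= a t IH; rewrite /qdim /= -/(qdim _) IH; lia. Qed.

Hypothesis char2 : (2 \in [pchar K])%N.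

Lemma nonsingular_binary : nonsingular binary.
Proof.
apply/nonsingularP => /=; rewrite tr_block_mx !tr_scalar_mx trmx0 add_block_mx.
rewrite -!raddfD /= !addrr_pchar2 // !raddf0 addr0 add0r.
pose J : 'M[K]_(1 + 1) := block_mx 0 1%:M 1%:M 0.
have [] // := @mulmx1_unit _ _ J J.
by rewrite mulmx_block !(mulmx0, mul0mx, mulmx1, addr0, add0r) -scalar_mx_block.
Qed.

Let ext_mx m p (W : 'M[K]_(m, p)) : 'M_(1 + m, (1 + 1) + p) :=
  block_mx (row_mx 1%:M 0) 0 0 W.
Let ext_row p : 'rV[K]_((1 + 1) + p) := row_mx (row_mx 0 1%:M) 0.

Let ext_mxE m p (W : 'M[K]_(m, p)) (x : 'rV_(1 + m)) y :
  x *m ext_mx W + y *: ext_row p = row_mx (row_mx (lsubmx x) y%:M) (rsubmx x *m W).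
Proof.
rewrite -{1}[x]hsubmxK mul_row_block !mulmx0 addr0 add0r mul_mx_row mulmx1 mulmx0.
rewrite /ext_row !scale_row_mx !scaler0 scale_scalar_mx mulr1 !add_row_mx.
by rewrite !addr0 !add0r.
Qed.

Let ext_mx_free m p (W : 'M[K]_(m, p)) (x : 'rV_(1 + m)) y : row_free W ->
  x *m ext_mx W + y *: ext_row p = 0 -> x = 0 /\ y = 0.
Proof.
move=> fW; rewrite ext_mxE => /eqP; rewrite !row_mx_eq0 => /andP[/andP[/eqP x0 /eqP y0]].
move=> /eqP; rewrite -[RHS](mul0mx _ W) => /(row_free_inj fW) x1; split.
  by rewrite -[x]hsubmxK x0 x1 row_mx0.
by have /matrixP/(_ 0 0) := y0; rewrite !mxE eqxx.
Qed.

Let qf_ext a t m (W : 'M_(m, qdim (binary_tensor t))) (x : 'rV_(1 + m)) y :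
  qf (tagged (binary_tensor (a :: t))) (x *m ext_mx W + y *: ext_row _) =
  a * (d * x 0 0 ^+ 2 + x 0 0 * y + e * y ^+ 2) +
  qf (tagged (binary_tensor t)) (rsubmx x *m W).
Proof.
rewrite ext_mxE (@qf_orth _ (scaleq a binary) (binary_tensor t)) qf_scale qf_binary.
rewrite !mxE eqxx mulr1n (_ : lshift m 0 = 0) //.
exact: val_inj.
Qed.

(** [W] collects the first basis vector of each summand b [d, e], on which the form is d times the
    diagonal one; [om] is the second basis vector of the leading summand alone, so it pairs only
    with the first row of [W]. *)
Lemma binary_tensor_diag a t : exists (W : 'M_((size t).+1, qdim (binary_tensor (a :: t))))
    (om : 'rV_(qdim (binary_tensor (a :: t)))),
  [/\ forall (x : 'rV_(size t).+1) y, x *m W + y *: om = 0 -> x = 0 /\ y = 0,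
      forall x, qf (tagged (binary_tensor (a :: t))) (x *m W) =
        d * \sum_(i < (size t).+1) (a :: t)`_i * x 0 i ^+ 2,
      qf (tagged (binary_tensor (a :: t))) om = a * e &
      forall x : 'rV_(size t).+1,
        bf (tagged (binary_tensor (a :: t))) (x *m W) om = a * x 0 0].
Proof.
have sumE (b : K) u (x : 'rV_(1 + size u)) :
  \sum_(i < (size u).+1) (b :: u)`_i * x 0 i ^+ 2 =
  b * x 0 0 ^+ 2 + \sum_(i < size u) u`_i * rsubmx x 0 i ^+ 2.
  rewrite big_ord_recl; congr (_ + _); apply: eq_bigr => i _ /=.
  by rewrite mxE; congr (_ * x 0 _ ^+ 2); apply: val_inj.
have [W [fW qW]] : exists W : 'M_(size t, qdim (binary_tensor t)), row_free W /\
    forall x, qf (tagged (binary_tensor t)) (x *m W) =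
              d * \sum_(i < size t) t`_i * x 0 i ^+ 2.
  elim: t => [|b t [W [fW qW]]].
    exists 0; split; first by rewrite /row_free mxrank0.
    by move=> x; rewrite mulmx0 qf0 big_ord0 mulr0.
  exists (ext_mx W); split.
    apply: row_freeI => x x0; have [] // := @ext_mx_free _ _ W x 0 fW.
    by rewrite scale0r addr0.
  move=> x; have := qf_ext b W x 0; rewrite scale0r addr0 qW => ->.
  by rewrite sumE; ring.
exists (ext_mx W), (ext_row _).
have qx (x : 'rV_(1 + size t)) : qf (tagged (binary_tensor (a :: t))) (x *m ext_mx W) =
    d * \sum_(i < (size t).+1) (a :: t)`_i * x 0 i ^+ 2.
  by have := qf_ext a W x 0; rewrite scale0r addr0 qW => ->; rewrite sumE; ring.
have qom : qf (tagged (binary_tensor (a :: t))) (ext_row _) = a * e.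
  have := qf_ext a W 0 1; rewrite mul0mx add0r scale1r => ->.
  by rewrite linear0 mul0mx qf0 !mxE; ring.
split=> // [x y|x]; first exact: ext_mx_free.
rewrite bfE qx qom -[ext_row _]scale1r qf_ext qW sumE.
by ring.
Qed.

(* The vectors v_i + W_i and w + om span a totally isotropic space. *)
Lemma binary_tensor_isot (psi : qform K) a t (V : 'M_((size t).+1, qdim psi)) w :
  (forall x, qf (tagged psi) (x *m V) =
     d * \sum_(i < (size t).+1) (a :: t)`_i * x 0 i ^+ 2) ->
  qf (tagged psi) w = a * e -> (forall x, bf (tagged psi) (x *m V) w = a * x 0 0) ->
  has_isot (orth psi (binary_tensor (a :: t))) (size t).+2.
Proof.
move=> qV qw bV; have [W [om [fW qW qom bW]]] := binary_tensor_diag a t.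
rewrite -addn1.
pose U : 'M_((size t).+1 + 1, qdim psi + qdim (binary_tensor (a :: t))) :=
  col_mx (row_mx V W) (row_mx w om).
have UE (x : 'rV_((size t).+1 + 1)) : x *m U =
  row_mx (lsubmx x *m V + rsubmx x 0 0 *: w) (lsubmx x *m W + rsubmx x 0 0 *: om).
  rewrite -{1}[x]hsubmxK mul_row_col [rsubmx x in LHS]mx11_scalar mul_scalar_mx.
  by rewrite mul_mx_row scale_row_mx add_row_mx.
exists U; split.
  apply: row_freeI => x; rewrite UE => /eqP; rewrite row_mx_eq0 => /andP[_ /eqP].
  move=> /fW [x0 x1]; rewrite -[x]hsubmxK x0 [rsubmx x]mx11_scalar x1 raddf0.
  exact: row_mx0.
move=> x; rewrite UE (@qf_orth _ psi (binary_tensor (a :: t))).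
by rewrite !(qfD, qfZ, bfZr) qV qW qw qom bV bW addrr_pchar2.
Qed.

End BinaryTensor.

Lemma bf_suml (R : comNzRingType) n (A : 'M[R]_n) m (w : nat -> 'rV_n) (x : nat -> R) y :
  bf A (\sum_(i < m) x i *: w i) y = \sum_(i < m) x i * bf A (w i) y.
Proof.
elim: m => [|m IH]; first by rewrite !big_ord0 bf0l.
by rewrite !big_ord_recr /= bfDl bfZl IH.
Qed.

Lemma qf_orthogonal_sum (R : comNzRingType) n (A : 'M[R]_n) m (w : nat -> 'rV_n)
    (x : nat -> R) : (forall i k, (k < i < m)%N -> bf A (w k) (w i) = 0) ->
  qf A (\sum_(i < m) x i *: w i) = \sum_(i < m) x i ^+ 2 * qf A (w i).
Proof.
elim: m => [|m IH] ort; first by rewrite !big_ord0 qf0.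
rewrite !big_ord_recr /= qfD qfZ IH => [|i k /andP[ki im]]; last by rewrite ort // ki ltnW.
rewrite bf_suml [X in _ + X]big1 ?addr0 // => i _.
by rewrite bfZr ort ?mulr0 // ltnSn andbT.
Qed.

(** The w_i span a space on which the polar form vanishes, and nonsingularity provides a vector [w0]
    pairing to a with the first of them and to 0 with the others. Put s = psi(w0) / a. Adding s
    times the first vector keeps these pairings and changes the value to s a + s^2 d a + s a = a d
    s^2. This is the origin of the coefficient d s^2, which involves the unknown s only through its
    square. *)
Lemma diagonal_subform_isot (K : fieldType) (psi : qform K) d a t (w : nat -> 'rV_(qdim psi)) :
  (2 \in [pchar K])%N -> nonsingular psi -> d != 0 -> a != 0 ->
  aniso (diag_mx (\row_(i < (size t).+1) (a :: t)`_i)) ->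
  (forall i, (i < (size t).+1)%N -> qf (tagged psi) (w i) = d * (a :: t)`_i) ->
  (forall i k, (k < i < (size t).+1)%N -> bf (tagged psi) (w k) (w i) = 0) ->
  exists s, has_isot (orth psi (binary_tensor d (d * s ^+ 2) (a :: t))) (size t).+2.
Proof.
move=> char2 ns d0 a0 an qw bw; set N := (size t).+1 in an qw bw *.
pose V : 'M_(N, qdim psi) := \matrix_(i < N) w i.
have qV (x : 'rV_N) : qf (tagged psi) (x *m V) = d * \sum_(i < N) (a :: t)`_i * x 0 i ^+ 2.
  have -> : x *m V = \sum_(i < N) x 0 (inord i) *: w i.
    rewrite mulmx_sum_row; apply: eq_bigr => i _.
    by rewrite rowK inord_val.
  rewrite (@qf_orthogonal_sum _ _ _ N w (fun i => x 0 (inord i))) // mulr_sumr.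
  by apply: eq_bigr => i _; rewrite qw ?ltn_ord // inord_val; ring.
have fV : row_free V.
  apply: row_freeI => x xV; apply: an; rewrite qf_diag.
  have /eqP := qV x; rewrite xV qf0 eq_sym mulf_eq0 (negPf d0) => /eqP e.
  by rewrite -[RHS]e; apply: eq_bigr => i _; rewrite mxE.
have bVV x y : bf (tagged psi) (x *m V) (y *m V) = 0.
  rewrite bfE -mulmxDl !qV -!mulrBr -!sumrB big1 ?mulr0 // => i _.
  rewrite mxE; set c := _`_i; set x' := x _ _; set y' := y _ _.
  have -> : c * (x' + y') ^+ 2 - c * x' ^+ 2 - c * y' ^+ 2 = (x' * y' * c) + (x' * y' * c).
    by ring.
  by rewrite addrr_pchar2.
set M := tagged psi + (tagged psi)^T.
have [B VB] : exists B, V *m M *m B = 1%:M.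
  apply/row_freeP; rewrite /row_free mxrankMfree //.
  by rewrite row_free_unit; apply/nonsingularP.
pose w0 : 'rV_(qdim psi) := (B *m (a *: delta_mx 0 0 : 'cV_N))^T.
have bVw0 x : bf (tagged psi) (x *m V) w0 = a * x 0 0.
  rewrite /bf trmxK -/M !mulmxA -[x *m V *m M]mulmxA -[x *m _ *m B]mulmxA VB mulmx1.
  by rewrite -scalemxAr -colE !mxE.
pose s := qf (tagged psi) w0 / a; pose v0 := (delta_mx 0 0 : 'rV_N) *m V.
have qv0 : qf (tagged psi) v0 = d * a.
  rewrite qV big_ord_recl big1 => [|i _]; rewrite !mxE ?eqxx //=.
    by rewrite expr1n mulr1 addr0.
  by rewrite expr0n mulr0.
exists s; apply: (binary_tensor_isot char2 (V := V) (w := w0 + s *: v0)) => //.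
- rewrite qfD qfZ bfZr qv0 bfC bVw0 !mxE eqxx mulr1.
  have -> : qf (tagged psi) w0 = s * a by rewrite divfK.
  by rewrite addrAC addrr_pchar2 // add0r; ring.
- by move=> x; rewrite bfDr bfZr bVV mulr0 addr0.
Qed.

(** * Kernels of function fields *)

Section WittMap.
Variables (F K : fieldType) (f : {rmorphism F -> K}).

Lemma Wq_map0 : Wq_map f 0 = 0.
Proof. by apply: (addIr (Wq_map f 0)); rewrite -Wq_mapD !add0r. Qed.

Lemma Wq_map_eq0 (phi : nsform F) : Wq_map f (wclass phi) = 0 <->
  witt_equiv (map_qform f (val phi)) (Defs.zeroq K 0).
Proof. by rewrite Wq_mapE; apply: wclassP. Qed.

Lemma Wq_map_wsc a w : Wq_map f (wsc a w) = wsc (f a) (Wq_map f w).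
Proof.
have [->|a0] := eqVneq a 0; first by rewrite rmorph0 !wsc0 Wq_map0.
have fa0 : f a != 0 by rewrite fmorph_eq0.
rewrite -(wreprK w) (wsc_class a0) !Wq_mapE (wsc_class fa0); apply: wclass_isom => /=.
rewrite (_ : map_qform f _ = scaleq (f a) (map_qform f (val (wrepr w)))).
  exact: isom_refl.
by rewrite /map_qform /scaleq /= map_mxZ.
Qed.

Definition nzmap (a : nzelt F) : nzelt K :=
  exist _ (f (val a)) (etrans (congr1 negb (fmorph_eq0 f (val a))) (valP a)).

Lemma pfister_entries_map (s : seq (nzelt F)) :
  pfister_entries (map nzmap s) = map f (pfister_entries s).
Proof.
elim: s => [|a s IH]; first by rewrite /pfister_entries /= rmorph1.
rewrite map_cons !pfister_entries_cons IH map_cat -!map_comp; congr (_ ++ _).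
by apply: eq_map => b /=; rewrite rmorphM.
Qed.

Lemma Wq_map_pfister (s : seq (nzelt F)) w :
  Wq_map f (Wq_act (pfister s) w) = Wq_act (pfister (map nzmap s)) (Wq_map f w).
Proof.
rewrite !pfister_actE pfister_entries_map (big_morph _ (Wq_mapD f) Wq_map0).
by rewrite !big_map; apply: eq_bigr => b _; rewrite Wq_map_wsc.
Qed.

Lemma map_binary_tensor d e t :
  map_qform f (binary_tensor d e t) = binary_tensor (f d) (f e) (map f t).
Proof.
elim: t => [|a t IH] /=; first exact: map_zeroq.
rewrite map_orth IH; congr (orth _ _).
rewrite /map_qform /scaleq /= map_mxZ map_block_mx map_mx0 !map_scalar_mx.
by rewrite rmorph1.
Qed.

End WittMap.

Lemma Wq_map_comp (F K L : fieldType) (f : {rmorphism F -> K})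
    (g : {rmorphism K -> L}) w :
  Wq_map (g \o f : {rmorphism F -> L}) w = Wq_map g (Wq_map f w).
Proof.
rewrite -(wreprK w) !Wq_mapE; apply: wclass_isom => /=.
rewrite (@map_qform_comp _ _ _ f g (g \o f)) //; exact: isom_refl.
Qed.

Lemma wclass_dim0 (F : fieldType) (phi : nsform F) : qdim (val phi) = 0%N -> wclass phi = 0.
Proof.
have iso0 (psi : qform F) : qdim psi = 0%N -> isometric psi (Defs.zeroq F 0).
  case: psi => n A; rewrite /qdim /= => n0; subst n.
  by rewrite [A]thinmx0; exact: isom_refl.
by move=> n0; apply: (wclass_isom (psi := mk_nsform (@nonsingular_zeroq0 F))); exact: iso0.
Qed.

Lemma pfister_entries_neq0 (F : fieldType) (s : seq (nzelt F)) b :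
  b \in pfister_entries s -> b != 0.
Proof. by case/mapP => -[a a0] _ ->. Qed.

Lemma pfister_entries_gt0 (F : fieldType) (s : seq (nzelt F)) :
  (0 < size (pfister_entries s))%N.
Proof.
elim: s => [//|a s IH]; rewrite pfister_entries_cons size_cat.
exact: leq_trans IH (leq_addr _ _).
Qed.

Lemma class_binary_tensor (F : fieldType) (char2 : (2 \in [pchar F])%N) d e (t : seq F) :
  (forall b, b \in t -> b != 0) -> exists tau : nsform F,
    val tau = binary_tensor d e t /\
    wclass tau = \sum_(b <- t) wsc b (wclass (mk_nsform (@nonsingular_binary F d e char2))).
Proof.
elim: t => [|b t IH] t0.
  exists (mk_nsform (@nonsingular_zeroq0 F)); split=> //; rewrite big_nil.
  by apply: wclass_dim0.
have [|tau [vtau ctau]] := IH; first by move=> a at_; apply: t0; rewrite inE at_ orbT.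
have b0 : b != 0 by apply: t0; rewrite mem_head.
exists (nsorth (nsscale b0 (mk_nsform (@nonsingular_binary F d e char2))) tau); split.
  by rewrite /= vtau.
by rewrite big_cons -ctau (wsc_class b0) wclassD.
Qed.

Lemma map_qform_of_bform (F K : fieldType) (f : {rmorphism F -> K}) (s : seq (nzelt F)) :
  map_qform f (qform_of_bform s) =
  diag_qform (size s) (fun i => f (nth 0 [seq val a | a <- s] i)).
Proof.
rewrite /map_qform /diag_qform /=; congr existT; apply/matrixP => u v; rewrite !mxE.
rewrite (tnth_nth (nz1 F)) (nth_map (nz1 F)) ?ltn_ord //.
by rewrite rmorphMn.
Qed.

Lemma qf_zeroq (K : fieldType) m (x : 'rV[K]_m) : qf (tagged (Defs.zeroq K m)) x = 0.
Proof. by rewrite /qf mulmx0 mul0mx mxE. Qed.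

Lemma qf_map_orth (F K : fieldType) (f : {rmorphism F -> K}) (phi psi : qform F) x y :
  qf (map_mx f (tagged (orth phi psi))) (row_mx x y) =
  qf (map_mx f (tagged phi)) x + qf (map_mx f (tagged psi)) y.
Proof.
rewrite /qf /= map_block_mx !map_mx0 mul_row_block !mulmx0 addr0 add0r.
by rewrite tr_row_mx mul_row_col mxE.
Qed.

Lemma dsum_map (F K : fieldType) (f : F -> K) (u : seq F) x :
  dsum (map f u) x = \sum_(i < size u) f u`_i * x i ^+ 2.
Proof.
rewrite /dsum -(big_mkord xpredT (fun i => (map f u)`_i * x i ^+ 2)) size_map big_mkord.
by apply: eq_bigr => i _; rewrite (nth_map 0).
Qed.

(** * Comparison of W_q(L/F) with W_q(K/F) and the multiples of B_0 *)

Section KernelOfFunctionField.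
Variables (F K L : fieldType) (iota : {rmorphism F -> K}) (j : {rmorphism K -> L}).
Variables (sB sB0 : seq (nzelt F)).
Hypothesis char2 : (2 \in [pchar F])%N.
Hypothesis insep : forall x : K, exists y : F, x ^+ 2 = iota y.
Local Notation B := (pfister sB).
Local Notation B0 := (pfister sB0).
Hypothesis an_part : anisotropic_part (map_qform iota (qform_of_bform B))
                                      (map_qform iota (qform_of_bform B0)).
Hypothesis ff : quadric_function_field j (map_qform iota (qform_of_bform B)).
Hypothesis sub : {subset pfister_entries sB0 <= pfister_entries sB}.

Let t := pfister_entries sB.
Let t0 := pfister_entries sB0.
Let N := (size t).-1.
Let c i := iota t`_i.

Let char2K : (2 \in [pchar K])%N.
Proof. exact: (rmorph_pchar iota) char2. Qed.

Let size_t : size t = N.+1.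
Proof. by rewrite prednK // pfister_entries_gt0. Qed.

Let qB : map_qform iota (qform_of_bform B) = diag_qform N.+1 c.
Proof. by rewrite map_qform_of_bform -size_t /t /pfister_entries size_map. Qed.

Let ffN : quadric_function_field j (diag_qform N.+1 c).
Proof. by rewrite -qB. Qed.

Let c_neq0 i : (i <= N)%N -> c i != 0.
Proof.
move=> le_iN; rewrite fmorph_eq0; apply: (@pfister_entries_neq0 _ sB).
by apply: mem_nth; rewrite -/t size_t.
Qed.

Let an0 : aniso (diag_mx (\row_(i < size t0) iota t0`_i)).
Proof.
have [an _] := an_part; move: an; rewrite map_qform_of_bform.
by rewrite -(size_map val (pfister sB0)).
Qed.

Let entry i : (i < size t0)%N -> exists2 k, (k <= N)%N & t0`_i = t`_k.
Proof.
move=> lt_i; have /(nthP 0) [k lt_k tk] := sub (mem_nth 0 lt_i).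
by exists k => //; rewrite -ltnS -size_t.
Qed.

(* Two distinct entries of B0 with the same square class would make B0 isotropic. *)
Let entries_indep i k b b' : (i < size t0)%N -> (k < size t0)%N -> i != k ->
  b' != 0 -> iota t0`_i * b ^+ 2 <> iota t0`_k * b' ^+ 2.
Proof.
move=> lt_i lt_k ne_ik b0 e.
pose x : 'rV[K]_(size t0) := b *: delta_mx 0 (Ordinal lt_i) + b' *: delta_mx 0 (Ordinal lt_k).
have neK : Ordinal lt_k != Ordinal lt_i by rewrite -val_eqE eq_sym.
have /an0 x0 : qf (diag_mx (\row_(i < size t0) iota t0`_i)) x = 0.
  rewrite qf_diag (bigD1 (Ordinal lt_i)) // (bigD1 (Ordinal lt_k)) //=.
  rewrite big1 => [|l /andP[nl1 nl2]]; last first.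
    by rewrite !mxE (negPf nl1) (negPf nl2) /= !mulr0 addr0 expr0n mulr0.
  rewrite !mxE !eqxx (negPf neK) eq_sym (negPf neK) /= !mulr1 !mulr0 !addr0 add0r.
  by rewrite e addrr_pchar2.
have /rowP/(_ (Ordinal lt_k)) := x0; rewrite !mxE !eqxx (negPf neK) /=.
by rewrite mulr0 mulr1 add0r => /eqP; rewrite (negPf b0).
Qed.

(** Two entries of B_0 occur among those of B; were all entries of B in the square class of c_N over
    K, these two would contradict [entries_indep]. *)
Let nonsquare : (1 < size t0)%N ->
  exists2 i0, (i0 < N)%N & forall b, c i0 <> c N * b ^+ 2.
Proof.
move=> gt1; apply: contrapT => h.
have sq k : (k <= N)%N -> exists2 b, b != 0 & c k = c N * b ^+ 2.
  rewrite leq_eqVlt => /orP[/eqP ->|lt_k].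
    by exists 1; rewrite ?oner_neq0 // expr1n mulr1.
  have [b cb] : exists b, c k = c N * b ^+ 2.
    by apply: contrapT => nb; apply: h; exists k => // b cb; apply: nb; exists b.
  exists b => //; apply: contraTneq (c_neq0 (ltnW lt_k)) => b0.
  by rewrite cb b0 expr0n mulr0 negbK.
have [k lek tk] := entry (ltnW gt1); have [l lel tl] := entry gt1.
have [b b0 cb] := sq _ lek; have [b' b0' cb'] := sq _ lel.
apply: (@entries_indep 0%N 1%N b' b) => //; first exact: ltnW.
by rewrite tk tl [iota _]cb [iota t`_l]cb' mulrAC.
Qed.

Let kernel_sub w : Wq_map iota w = 0 -> Wq_map (j \o iota : {rmorphism F -> L}) w = 0.
Proof. by move=> w0; rewrite Wq_map_comp w0 Wq_map0. Qed.

Let isometry_mx : exists m (G : 'M[K]_(N.+1, size t0 + m)), [/\ row_full G &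
  forall x, qf (diag_mx (\row_(i < N.+1) c i)) x =
    qf (tagged (orth (diag_qform (size t0) (fun i => iota t0`_i)) (Defs.zeroq K m))) (x *m G)].
Proof.
have [_ [m iso]] := an_part; exists m.
have {}iso : isometric (diag_qform N.+1 c)
    (orth (diag_qform (size t0) (fun i => iota t0`_i)) (Defs.zeroq K m)).
  move: iso; rewrite qB [X in orth X _]map_qform_of_bform.
  by rewrite -(size_map val (pfister sB0)).
have [G [/eqP fG qG]] := isometric_mxP iso; exists G; split=> [|x]; last by rewrite qG.
by have e := isometric_dim iso; rewrite /row_full fG; apply/eqP.
Qed.

Lemma kernel_split : size t0 = 1%N ->
  Wq_ker (j \o iota : {rmorphism F -> L}) = Wq_ker iota.
Proof.
move=> size1; apply/seteqP; split=> w /=; last exact: kernel_sub.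
rewrite /Wq_ker /= Wq_map_comp => w0.
have [phi [an _ eqv]] := rational_anisotropic_part char2 insep (wrepr w).
have ew : Wq_map iota w = wclass (nsmap iota phi).
  by rewrite -(wreprK w) !Wq_mapE; apply/wclassP.
rewrite ew; apply: wclass_dim0; rewrite ew in w0.
have [m [G [_ qG]]] := isometry_mx.
have lt0 : (0 < size t0)%N by rewrite size1.
(* Every entry of B is a value of q_K, hence of its one-dimensional anisotropic part; so all entries
   share one square class over K and u is a square. *)
have val_c i : (i <= N)%N -> exists y, c i = iota t0`_0 * y ^+ 2.
  move=> lt_i; pose o : 'I_N.+1 := inord i.
  exists (lsubmx ((delta_mx 0 o : 'rV_N.+1) *m G) 0 (Ordinal lt0)).
  have <- : qf (diag_mx (\row_(k < N.+1) c k)) (delta_mx 0 o) = c i.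
    rewrite qf_diag (bigD1 o) //= big1 => [|k ne_k]; rewrite !mxE ?eqxx ?inordK //=.
      by rewrite expr1n mulr1 addr0.
    by rewrite (negPf ne_k) expr0n mulr0.
  rewrite qG -[X in qf _ X]hsubmxK.
  rewrite (@qf_orth _ (diag_qform (size t0) (fun i => iota t0`_i)) (Defs.zeroq K m)).
  rewrite qf_zeroq addr0 qf_diag (bigD1 (Ordinal lt0)) //= big1 => [|k].
    by rewrite addr0 !mxE.
  rewrite -val_eqE -lt0n /= => k0.
  by have := leq_trans (ltn_ord k) (eq_leq size1); rewrite ltnS leqNgt k0.
have [yN cN] := val_c N (leqnn N); have cN0 := c_neq0 (leqnn N).
apply: (function_field_split char2K cN0 ffN an (psi := map_qform iota (val phi))).
  exact: (proj1 (Wq_map_eq0 j (nsmap iota phi))) w0.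
move=> i lt_i; have [y cy] := val_c i (ltnW lt_i); exists (y / yN).
have yN0 : yN != 0 by apply: contraNneq cN0 => y0; rewrite cN y0 expr0n mulr0.
by rewrite cy cN; field.
Qed.

(** Over L the form B_0 acquires an isotropic vector, namely the image of the generic point under
    the projection to the anisotropic part. *)
Let pfister_kills w : (1 < size t0)%N ->
  Wq_map (j \o iota : {rmorphism F -> L}) (Wq_act B0 w) = 0.
Proof.
move=> gt1; have [i0 lt_i0 nsq] := nonsquare gt1.
have [x [_ x_gen _]] := ffN; have [m [G [fG qG]]] := isometry_mx.
pose A1 := diag_mx (\row_(i < N.+1) c i).
pose q0 := diag_qform (size t0) (fun i => iota t0`_i).
pose A2 := tagged (orth q0 (Defs.zeroq K m)).
pose X : 'rV[L]_N.+1 := \row_i x i.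
have homq : Defs.qpoly (diag_qform N.+1 c) \is 2.-homog.
  rewrite qpoly_diag; apply: rpred_sum => i _; apply: rpredZ.
  by rewrite -[2%N]mul1n; apply: dhomogMn; rewrite dhomogX; apply/eqP; exact: mdeg1.
have qX : qf (map_mx j A1) X = 0.
  have := (x_gen _ _ homq).2; rewrite qpoly_diag rmorph_sum /= => e.
  rewrite /A1 map_diag_mx qf_diag -[RHS]e; last first.
    by exists 1%N, 1; rewrite mul1r -qpoly_diag.
  apply: eq_bigr => i _; rewrite -mul_mpolyC rmorphM rmorphXn /= mmapC mmapX mmap1U.
  by rewrite !mxE.
have qGL : qf (map_mx j A2) (X *m map_mx j G) = 0.
  (* Equal values over K do not make the two matrices equal, but their difference is alternating, so
     the values still agree over L. *)
  have h (y : 'rV[K]_N.+1) : (y *m (G *m A2 *m G^T - A1) *m y^T) 0 0 = 0.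
    have subE (P Q : 'M[K]_1) : (P - Q) 0 0 = P 0 0 - Q 0 0 by rewrite !mxE.
    by rewrite mulmxBr mulmxBl subE -/(qf _ y) -/(qf A1 y) -qf_mul -qG subrr.
  have := map_qval0 j h X; rewrite map_mxB !map_mxM -map_trmx mulmxBr mulmxBl.
  have subE (P Q : 'M[L]_1) : (P - Q) 0 0 = P 0 0 - Q 0 0 by rewrite !mxE.
  by rewrite subE -/(qf _ X) -/(qf (map_mx j A1) X) qX subr0 -qf_mul.
pose y : 'rV[L]_(size t0) := lsubmx (X *m map_mx j G).
have qy : \sum_(i < size t0) j (iota t0`_i) * y 0 i ^+ 2 = 0.
  rewrite -[RHS]qGL -[X *m _]hsubmxK -/y.
  rewrite (@qf_map_orth _ _ j q0 (Defs.zeroq K m)) /= map_mx0.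
  rewrite [X in _ + X](qf_zeroq (rsubmx _)) addr0.
  by rewrite map_diag_mx qf_diag; apply: eq_bigr => i _; rewrite !mxE.
(* If the image were 0, its first coordinate would be a linear form over K vanishing at the generic
   point, hence with zero coefficients. A column of [G] would then vanish, although [G] has full row
   space. *)
have [k yk] : exists k, y 0 k != 0.
  apply/existsP; apply: contraT; rewrite negb_exists => /forallP y0; exfalso.
  pose k0 : 'I_(size t0) := Ordinal (ltnW gt1); pose k := lshift m k0.
  pose l i := G (inord i) k.
  have homl : \sum_(i < N.+1) l i *: 'X_i \is [in K[N.+1], 1.-homog].
    apply: rpred_sum => i _; apply: rpredZ.
    by rewrite dhomogX; apply/eqP; exact: mdeg1.
  have [|r [g e]] := (x_gen _ _ homl).1.
    have := y0 k0; rewrite negbK => /eqP yk0; rewrite -[RHS]yk0 rmorph_sum !mxE.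
    by apply: eq_bigr => i _ /=; rewrite mmapZ mmapX mmap1U !mxE mulrC /l inord_val.
  have l0 := linear_form_radical char2K (c_neq0 (leqnn N)) lt_i0 nsq e.
  have /submxP[D De] := submx_full (delta_mx 0 k : 'rV_(size t0 + m)) fG.
  have := congr1 (fun M : 'rV_(size t0 + m) => M 0 k) De.
  rewrite !mxE !eqxx big1 => [/eqP|i _]; first by rewrite oner_eq0.
  by have := l0 i (ltn_ord i); rewrite /l inord_val => ->; rewrite mulr0.
rewrite Wq_map_pfister.
pose x' i := if insub i is Some o then y 0 o else 0.
apply: (@pfister_isotropic _ _ _ x' _ k).
- exact: (rmorph_pchar (j \o iota)) char2.
- by rewrite pfister_entries_map (size_map _ t0) ltn_ord.
- by rewrite /x' (valK k).
- rewrite pfister_entries_map dsum_map -[RHS]qy; apply: eq_bigr => i _.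
  by rewrite /x' (valK i).
Qed.

Let dimension_drop (phi : nsform F) : (1 < size t0)%N ->
  aniso (map_mx iota (tagged (val phi))) -> (0 < qdim (val phi))%N ->
  Wq_map (j \o iota : {rmorphism F -> L}) (wclass phi) = 0 ->
  exists v (phi' : nsform F), (qdim (val phi') < qdim (val phi))%N /\
    Wq_map iota (wclass phi + Wq_act B0 v + wclass phi') = 0.
Proof.
move=> gt1 an n_gt0 phi0; have [i0 lt_i0 nsq] := nonsquare gt1.
have cN0 := c_neq0 (leqnn N); set A := tagged (val phi) in an *.
(* Taking e over F puts the multiplier d = phi(e) / c_N in the image of F. *)
pose e : 'rV[F]_(qdim (val phi)) := delta_mx 0 (Ordinal n_gt0).
have qe0 : qf A e != 0.
  apply/eqP => qe; have /matrixP/(_ 0 (Ordinal n_gt0)) : map_mx iota e = 0.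
    by apply: an; rewrite map_qf qe rmorph0.
  by rewrite !mxE !eqxx rmorph1 => /eqP; rewrite oner_eq0.
have hyp : witt_equiv (map_qform j (map_qform iota (val phi))) (Defs.zeroq L 0).
  apply: (proj1 (Wq_map_eq0 j (nsmap iota phi))).
  by rewrite -(Wq_mapE iota phi) -Wq_map_comp.
have [w wP] := function_field_subform char2K cN0 ffN (psi := map_qform iota (val phi))
  an hyp lt_i0 nsq (map_mx iota e).
have [kk kkP] : exists kk : nat -> nat, forall i, (i < size t0)%N ->
    (kk i <= N)%N /\ t0`_i = t`_(kk i).
  have ex i : exists k, (i < size t0)%N -> (k <= N)%N /\ t0`_i = t`_k.
    have [lt_i|_] := boolP (i < size t0)%N; last by exists 0%N.
    by have [k lek tk] := entry lt_i; exists k.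
  by have [kk kkP] := choice ex; exists kk.
pose d0 := qf A e / t`_N; pose d := iota d0.
have tN0 : t`_N != 0 by rewrite -(fmorph_eq0 iota).
have d_neq0 : d != 0 by rewrite fmorph_eq0 mulf_neq0 ?invr_eq0.
have qw i : (i < size t0)%N -> qf (map_mx iota A) (w (kk i)) = d * iota t0`_i.
  move=> lt_i; have [le_k ->] := kkP _ lt_i; have [-> _] := wP _ le_k.
  by rewrite /d /d0 fmorph_div -map_qf.
have bw i k : (k < i < size t0)%N -> bf (map_mx iota A) (w (kk k)) (w (kk i)) = 0.
  move=> /andP[lt_ki lt_i]; have lt_k := ltn_trans lt_ki lt_i.
  have [le_ki ti] := kkP _ lt_i; have [le_kk tk] := kkP _ lt_k.
  have [lt|lt|ekk] := ltngtP (kk i) (kk k).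
  - by have [_ ->] := wP _ le_kk.
  - by have [_ b0] := wP _ le_ki; rewrite bfC b0.
  - case: (@entries_indep i k 1 1 lt_i lt_k); rewrite ?oner_neq0 ?gtn_eqF //.
    by rewrite ti tk ekk.
have [s isot] : exists s, has_isot (orth (map_qform iota (val phi))
    (binary_tensor d (d * s ^+ 2) (map iota t0))) (size t0).+1.
  move: (an0) qw bw (@pfister_entries_neq0 _ sB0); rewrite -/t0.
  case: (t0) gt1 => // a t0' _ an' qw bw t0_neq0.
  have := @diagonal_subform_isot _ (map_qform iota (val phi)) d (iota a) (map iota t0')
    (fun i => w (kk i)) char2K; rewrite size_map => diso.
  apply: diso => //.
  - exact: nonsingular_map (nsformP phi).
  - by rewrite fmorph_eq0 t0_neq0 ?mem_head.
  - rewrite (_ : \row__ _ = \row_(i < (size t0').+1) iota (a :: t0')`_i) //.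
    by apply/rowP => i; rewrite !mxE -map_cons (nth_map 0).
  - by move=> i lt_i; rewrite qw // -map_cons (nth_map 0).
(* The vector producing s is defined over K only, but s^2 lies in F, so [d, d s^2] comes from a form
   over F. *)
have [y sy] := insep s.
have [tau [vtau ctau]] := class_binary_tensor char2 d0 (d0 * y) (t := t0)
   (fun b => @pfister_entries_neq0 _ sB0 b).
have [phi' [an' _ eqv]] := rational_anisotropic_part char2 insep (nsorth phi tau).
exists (wclass (mk_nsform (@nonsingular_binary F d0 (d0 * y) char2))), phi'.
have tauE : map_qform iota (val tau) = binary_tensor d (d * s ^+ 2) (map iota t0).
  by rewrite vtau map_binary_tensor sy -rmorphM.
split.
  have isot2 : has_isot (map_qform iota (val (nsorth phi tau))) (size t0).+1.
    by rewrite /= map_orth tauE.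
  have : (qdim (val phi') + (size t0).+1 + (size t0).+1 <=
          qdim (val phi) + qdim (val tau))%N := witt_aniso_dim eqv an' isot2.
  rewrite vtau qdim_binary_tensor.
  by lia.
rewrite pfister_actE -/t0 -ctau wclassD Wq_mapD !Wq_mapE.
rewrite (_ : wclass (nsmap iota (nsorth phi tau)) = wclass (nsmap iota phi')).
  exact: Wq_addrr.
exact/wclassP.
Qed.

Lemma kernel_pfister : (1 < size t0)%N ->
  Wq_ker (j \o iota : {rmorphism F -> L}) =
  [set u + v | u in Wq_ker iota & v in range (Wq_act B0)]%classic.
Proof.
move=> gt1; apply/seteqP; split=> [w|_ [u u0 [_ [v _ <-] <-]]]; last first.
  by rewrite /Wq_ker /= Wq_mapD kernel_sub // pfister_kills ?addr0.
have [n] := ubnP (qdim (val (wrepr w))); rewrite -{2 3}(wreprK w).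
move: (wrepr w) => phi {w}; elim: n phi => // n IH phi lt_n /= phi0.
have [phi1 [an le1 eqv]] := rational_anisotropic_part char2 insep phi.
have e1 : Wq_map iota (wclass phi) = Wq_map iota (wclass phi1).
  by rewrite !Wq_mapE; apply/wclassP.
have phi1_0 : Wq_map (j \o iota : {rmorphism F -> L}) (wclass phi1) = 0.
  by rewrite Wq_map_comp -e1 -Wq_map_comp.
have u1 : Wq_map iota (wclass phi + wclass phi1) = 0.
  by rewrite Wq_mapD e1 Wq_addrr.
have [d0|d_gt0] := posnP (qdim (val phi1)).
  exists (wclass phi + wclass phi1); first exact: u1.
  exists (Wq_act B0 0); first by exists 0.
  by rewrite (wclass_dim0 d0) addr0 pfister_actE big1 ?addr0 // => b _; rewrite wscr0.
have [v [phi2 [lt2 u2]]] := dimension_drop gt1 an d_gt0 phi1_0.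
have phi2_0 : Wq_map (j \o iota : {rmorphism F -> L}) (wclass phi2) = 0.
  have := kernel_sub u2; rewrite !Wq_mapD phi1_0 pfister_kills // !add0r.
  by [].
have [|u u0 [_ [v' _ <-] e2]] := IH phi2 _ phi2_0.
  by apply: leq_trans lt2 _; rewrite -ltnS; exact: leq_ltn_trans le1 lt_n.
(* The first two summands vanish over K by construction, and [u] comes from the decomposition of
   [phi2]. In the total with B_0 (v + v') the classes of [phi1] and B_0 v occur twice and cancel. *)
exists ((wclass phi + wclass phi1) + (wclass phi1 + Wq_act B0 v + wclass phi2) + u).
  by rewrite /Wq_ker /= Wq_mapD u0 addr0 Wq_mapD u1 u2 addr0.
exists (Wq_act B0 (v + v')); first by exists (v + v').
rewrite Wq_actD; set p := wclass phi; set p1 := wclass phi1; set x := Wq_act B0 v.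
have -> : p + p1 + (p1 + x + wclass phi2) + u + (x + Wq_act B0 v') =
  p + (p1 + p1) + (x + x) + (wclass phi2 + (u + Wq_act B0 v')).
  by rewrite [LHS](AC (2*3*1*2) (1*(2*3)*(4*7)*(5*(6*8)))).
by rewrite e2 !Wq_addrr // !addr0.
Qed.

End KernelOfFunctionField.

(** * Entries of the Pfister form of a subfamily *)

Lemma pfister_entries_filter (F : fieldType) (T : Type) (a : T -> nzelt F) (P : pred T) r :
  {subset pfister_entries (map a (filter P r)) <= pfister_entries (map a r)}.
Proof.
elim: r => [|x r IH] b //=; case: (P x) => /=; rewrite !pfister_entries_cons !mem_cat.
  case/orP=> [/IH -> //|/mapP [y /IH yr ->]].
  by apply/orP; right; apply: map_f.
by move/IH => ->.
Qed.

(** Both lists are strictly increasing with the same elements. Writing the subfamily as a filtered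
    list makes the entries of B_0 literally entries of B. *)
Lemma increasing_codom n k (i : 'I_k -> 'I_n) :
  (forall u v : 'I_k, (u < v)%N -> (i u < i v)%N) ->
  map i (enum 'I_k) = filter (mem (codom i)) (enum 'I_n).
Proof.
move=> incr; pose lt m := fun u v : 'I_m => (u < v)%N.
have lt_tr m : transitive (lt m) by move=> y x z; apply: ltn_trans.
have lt_irr m : irreflexive (lt m) by move=> x; apply: ltnn.
have sorted_enum m : sorted (lt m) (enum 'I_m).
  by have := iota_ltn_sorted 0 m; rewrite -val_enum_ord sorted_map.
apply: (irr_sorted_eq (lt_tr n) (lt_irr n)).
- rewrite sorted_map; apply: sub_sorted (sorted_enum k) => u v; exact: incr.
- by apply: sorted_filter; [exact: lt_tr | exact: sorted_enum].
- by move=> u; rewrite mem_filter mem_enum andbT.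
Qed.

Theorem corollary4p5 (F K L : fieldType)
    (iota : {rmorphism F -> K}) (j : {rmorphism K -> L})
    (n : nat) (a : 'I_n -> nzelt F) (k : nat) (i : 'I_k -> 'I_n)
    (char2 : (2 \in [pchar F])%N)
    (insep : forall x : K, exists y : F, x ^+ 2 = iota y)
    (n_gt0 : (1 <= n)%N) (k_le_n : (k <= n)%N)
    (i_incr : forall u v : 'I_k, (u < v)%N -> (i u < i v)%N)
    (B := pfister [seq a l | l : 'I_n])
    (B0 := pfister [seq a (i u) | u : 'I_k])
    (an_part : anisotropic_part (map_qform iota (qform_of_bform B))
                                (map_qform iota (qform_of_bform B0)))
    (L_ff : quadric_function_field j (map_qform iota (qform_of_bform B))) :
  let WqLF := Wq_ker (j \o iota : {rmorphism F -> L}) in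
  let WqKF := Wq_ker iota in
  (bdim B0 = 1%N -> WqLF = WqKF) /\
  ((1 < bdim B0)%N ->
     WqLF = [set u + v | u in WqKF & v in range (Wq_act B0)]%classic).
Proof.
have sub : {subset pfister_entries [seq a (i u) | u : 'I_k]
               <= pfister_entries [seq a l | l : 'I_n]}.
  rewrite /image_mem (map_comp a i) (increasing_codom i_incr).
  exact: pfister_entries_filter.
have dimE : bdim B0 = size (pfister_entries [seq a (i u) | u : 'I_k]).
  by rewrite size_map.
rewrite dimE; split=> dim.
  exact: kernel_split char2 insep an_part L_ff dim.
exact: kernel_pfister char2 insep an_part L_ff sub dim.
Qed.
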